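(* Let $f\in\mathcal{O}_0^K$ be tangent to the identity, $f(x)=x+a_mx^m+\cdots$ with $m\ge 2$ and $a_m\neq 0$. Fix an algebraic closure $\overline{K}$ of $K$, let $\lambda\in\overline{K}$ satisfy $\lambda^{m-1}=a_m$, and let $\widetilde K=K[\lambda]$. Write $L_\lambda(x)=\lambda x$. Then there exist $\mu\in\widetilde K$ and an analytic function $h\in\mathcal{O}_0^{\widetilde K}$ tangent to the identity such that $$h\circ\bigl(L_\lambda\circ f\circ L_\lambda^{-1}\bigr)\circ h^{-1}(x)=x+x^m+\mu x^{2m-1}.$$ Moreover, $m$ and $\mu$ are analytic invariants of $f$: if $g\in\mathcal{O}_0^K$ is tangent to the identity, $g\ne x$, if $g=k\circ f\circ k^{-1}$ for some $k\in\mathcal{O}_0^K$ with $k(0)=0$ and $k'(0)\neq 0$, and if $m'$, $\mu'\in\overline K$ are numbers obtained in this way for $g$ (for any choice of the $(m'-1)$-st root in $\overline K$ and of the conjugating map), then $m'=m$ and $\mu'=\mu$.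
   Context: $K$ is a field of characteristic $0$, complete with respect to a nontrivial non-archimedean absolute value $|\cdot|$. The absolute value extends uniquely to every finite extension of $K$, which is again complete; $\widetilde K$ carries this extension. For such a field $L$, $\mathcal{O}_0^L$ is the ring of power series in $L[[x]]$ with positive radius of convergence about $0$ (these are called analytic). A power series is tangent to the identity if it has the form $x+O(x^2)$. $\circ$ is composition and $h^{-1}$ is the compositional inverse. *)

(* Defs.v *)
From HB Require Import structures.
From mathcomp Require Import all_boot all_order all_algebra.
From mathcomp Require Import all_classical all_reals all_analysis.
Set Implicit Arguments.
Unset Strict Implicit.
Unset Printing Implicit Defensive.
Import Order.TTheory GRing.Theory Num.Theory.
Import numFieldNormedType.Exports.
Local Open Scope classical_set_scope.
Local Open Scope ring_scope.

Section Valued.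
Variables (R : realType) (L : fieldType).
Implicit Types (abs : L -> R) (S : set L).

Record nonarch_abs abs : Prop := NonarchAbs {
  nonarch_abs_ge0 : forall x, 0 <= abs x;
  nonarch_abs_eq0 : forall x, abs x = 0 <-> x = 0;
  nonarch_absM : forall x y, abs (x * y) = abs x * abs y;
  nonarch_absD : forall x y, abs (x + y) <= Num.max (abs x) (abs y) }.

Definition nontrivial_abs abs : Prop := exists2 x : L, x != 0 & abs x != 1.

Definition abs_cvg abs (u : nat -> L) (l : L) : Prop :=
  (fun n => abs (u n - l)) @ \oo --> (0 : R).

Definition abs_cauchy abs (u : nat -> L) : Prop :=
  forall e : R, 0 < e ->
    exists N, forall i j, (N <= i)%N -> (N <= j)%N -> abs (u i - u j) < e.

Definition complete_abs abs : Prop :=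
  forall u : nat -> L, abs_cauchy abs u -> exists l, abs_cvg abs u l.

(* The power series [a] belongs to O_0^S, for [S] (the carrier of) a subfield
   of [L] valued by the restriction of [abs]: coefficients, arguments and sums
   are all taken in [S]. *)
Definition analytic abs S (a : nat -> L) : Prop :=
  (forall n, S (a n)) /\
  exists2 r : R, 0 < r &
    forall x, S x -> abs x < r ->
      exists2 s, S s & abs_cvg abs (fun n => \sum_(i < n) a i * x ^+ i) s.

End Valued.

(* A formal power series over [L] is its coefficient sequence [nat -> L]. *)
Section PowerSeries.
Variable L : fieldType.
Implicit Types (a b f g h k : nat -> L).

Definition ps_one : nat -> L := fun n => (n == 0)%N%:R.

Definition ps_X : nat -> L := fun n => (n == 1)%N%:R.

Definition ps_mul a b : nat -> L :=
  fun n => \sum_(i < n.+1) a i * b (n - i)%N.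

Definition ps_exp b (i : nat) : nat -> L := iter i (ps_mul b) ps_one.

(* [a o b], for [b 0 = 0]: then [b ^ i] has no coefficient in degrees below
   [i], so that the coefficient of degree [n] only involves [i <= n]. *)
Definition ps_comp a b : nat -> L :=
  fun n => \sum_(i < n.+1) a i * ps_exp b i n.

Definition ps_linear (c : L) : nat -> L := fun n => c * (n == 1)%N%:R.

Definition ps_inverse h k : Prop :=
  [/\ h 0%N = 0, k 0%N = 0, ps_comp h k = ps_X & ps_comp k h = ps_X].

(* [g = h o f o h^-1] *)
Definition ps_conjugate h f g : Prop :=
  exists2 k, ps_inverse h k & g = ps_comp h (ps_comp f k).

Definition tangent_id f : Prop := f 0%N = 0 /\ f 1%N = 1.

(* [f = x + a_m x^m + ...] with [m >= 2] and [a_m = f m <> 0] *)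
Definition tangent_order f (m : nat) : Prop :=
  [/\ tangent_id f, (2 <= m)%N,
      forall i, (1 < i < m)%N -> f i = 0 & f m != 0].

(* [x + x^m + mu x^(2m-1)] *)
Definition ps_normal (m : nat) (mu : L) : nat -> L :=
  fun n => (n == 1)%N%:R + (n == m)%N%:R + mu * (n == 2 * m - 1)%N%:R.

End PowerSeries.

Definition is_algebraic_closure (K : fieldType) (Kbar : closedFieldType)
    (iota : {rmorphism K -> Kbar}) : Prop :=
  forall z : Kbar, algebraicOver iota z.

(* [K[lambda]], as a subset of [Kbar] *)
Definition adjoin (K : fieldType) (Kbar : closedFieldType)
    (iota : {rmorphism K -> Kbar}) (lambda : Kbar) : set Kbar :=
  [set (map_poly iota p).[lambda] | p in [set: {poly K}]].

(* [mu] is obtained for [f = x + a_m x^m + ...] from the root [lambda] of [a_m]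
   and the conjugating map [h]. *)
Definition normal_form (R : realType) (K : fieldType) (Kbar : closedFieldType)
    (iota : {rmorphism K -> Kbar}) (absbar : Kbar -> R)
    (f : nat -> K) (m : nat) (lambda mu : Kbar) (h : nat -> Kbar) : Prop :=
  [/\ tangent_order f m, lambda ^+ m.-1 = iota (f m),
      adjoin iota lambda mu,
      analytic absbar (adjoin iota lambda) h /\ tangent_id h &
      ps_conjugate h
        (ps_comp (ps_linear lambda)
           (ps_comp (fun n => iota (f n)) (ps_linear lambda^-1)))
        (ps_normal m mu)].

(* Main.v *)
Require Import Defs.
From HB Require Import structures.
From mathcomp Require Import all_boot all_order all_algebra.
From mathcomp Require Import all_classical all_reals all_analysis.
From mathcomp Require Import zify ring lra.
Set Implicit Arguments.
Unset Strict Implicit.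
Unset Printing Implicit Defensive.
Import Order.TTheory GRing.Theory Num.Theory.
Import numFieldNormedType.Exports.
Local Open Scope classical_set_scope.
Local Open Scope ring_scope.

(* In characteristic 0 a series [f = x + a x^m + ...] leaves invariant exactly one
   vector field [v d/dx] with [v = a x^m + ...]: Julia's equation [v o f = f' v]
   is linear in [v], and solving it degree by degree only divides by products
   [(n - m)!], whose inverses grow geometrically for a non-archimedean absolute
   value.  So [v] is analytic.  Conversely [v] and the coefficient of [x^m]
   determine [f], so it suffices to conjugate vector fields.

   Write [dx / v = x^-m W dx] with residue [r = W_(m-1)].  After integration, the
   equation saying that [h = x e^w] carries [v] to the vector field
   [x^m / (1 + r x^(m-1)) d/dx] becomes an implicit equation in [w], without small
   divisors, so [h] is analytic.  The invariant field of [x + x^m + mu x^(2m-1)]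
   has residue [binomial(m, 2) / (m - 1) - mu], hence a suitable [mu] makes the
   residues agree.

   The invariance of [m] and [mu] is read off the first coefficients of a
   conjugation between two normal forms. *)

(** Solving [h o F = N o h] directly, degree by degree, also divides by integers, but there the
    quotients re-enter through powers of [h]; in Julia's equation they merely accumulate as a
    product. The residues have to agree because the primitive of [dx / v] contains [r log x]: with
    [h = x e^w] the two logarithms cancel, and an equation between power series remains. Convergence
    is kept apart from algebra. Analyticity is replaced by [|a_n| <= r ^ n.+1], which ultrametric
    estimates carry through products, composition, reciprocals and implicit equations. Fixed points
    are taken in the [x]-adic sense, with a coefficientwise bound kept along the iteration, so no
    limit in the field is involved there. Sums of series occur only at both ends: convergence of [f]
    at one nonzero point gives the bound, and the bound gives convergence of [h] with sums in
    [K[lambda]], which is complete as a finite-dimensional space over [K], whereas [Kbar] need not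
    be complete. *)

(* A separate name for [nat -> L], because the latter already carries the
   pointwise ring structure. *)
Definition fps (L : fieldType) : Type := nat -> L.

(** * The ring of formal power series *)

Section FpsRing.
Variable L : fieldType.
Implicit Types a b c : fps L.

HB.instance Definition _ := gen_eqMixin (fps L).
HB.instance Definition _ := gen_choiceMixin (fps L).

Definition fps_zero : fps L := fun=> 0.
Definition fps_opp a : fps L := fun n => - a n.
Definition fps_add a b : fps L := fun n => a n + b n.

Fact fps_addA : associative fps_add.
Proof. by move=> a b c; apply/funext => n; exact: addrA. Qed.
Fact fps_addC : commutative fps_add.
Proof. by move=> a b; apply/funext => n; exact: addrC. Qed.
Fact fps_add0 : left_id fps_zero fps_add.
Proof. by move=> a; apply/funext => n; exact: add0r. Qed.
Fact fps_addN : left_inverse fps_zero fps_opp fps_add.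
Proof. by move=> a; apply/funext => n; exact: addNr. Qed.

HB.instance Definition _ :=
  GRing.isZmodule.Build (fps L) fps_addA fps_addC fps_add0 fps_addN.

Definition fps_mul a b : fps L := ps_mul a b.
Definition fps_one : fps L := ps_one L.

(** Degrees up to [n] of a product only see the truncations at [n], so associativity and
    commutativity come from [{poly L}]. *)
Definition fps_trunc n a : {poly L} := \poly_(i < n.+1) a i.

Lemma coef_fps_trunc n a i : (i <= n)%N -> (fps_trunc n a)`_i = a i.
Proof. by move=> le_in; rewrite coef_poly ltnS le_in. Qed.

Lemma coef_fps_truncM n a b i : (i <= n)%N ->
  (fps_trunc n a * fps_trunc n b)`_i = fps_mul a b i.
Proof.
move=> le_in; rewrite coefM; apply: eq_bigr => j _.
by rewrite !coef_fps_trunc //; have := ltn_ord j; lia.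
Qed.

Fact fps_mulA : associative fps_mul.
Proof.
move=> a b c; apply/funext => n.
transitivity (fps_trunc n a * fps_trunc n b * fps_trunc n c)`_n.
  rewrite -mulrA coefM; apply: eq_bigr => j _.
  by rewrite coef_fps_trunc ?coef_fps_truncM //; have := ltn_ord j; lia.
rewrite coefM; apply: eq_bigr => j _.
by rewrite coef_fps_trunc ?coef_fps_truncM //; have := ltn_ord j; lia.
Qed.

Fact fps_mulC : commutative fps_mul.
Proof.
move=> a b; apply/funext => n.
by rewrite -[LHS](coef_fps_truncM _ _ (leqnn n)) mulrC coef_fps_truncM.
Qed.

Fact fps_mul1 : left_id fps_one fps_mul.
Proof.
move=> a; apply/funext => n.
rewrite /fps_mul /ps_mul big_ord_recl /= subn0 /fps_one /ps_one eqxx mul1r.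
by rewrite big1 ?addr0 // => i _; rewrite /= mul0r.
Qed.

Fact fps_mulDl : left_distributive fps_mul fps_add.
Proof.
move=> a b c; apply/funext => n.
rewrite /fps_add /fps_mul /ps_mul -big_split.
by apply: eq_bigr => i _; rewrite mulrDl.
Qed.

Fact fps_one_neq0 : fps_one != 0.
Proof.
by apply/eqP => /(congr1 (fun a : fps L => a 0%N)) /eqP; rewrite (oner_eq0 L).
Qed.

HB.instance Definition _ := GRing.Zmodule_isComNzRing.Build (fps L)
  fps_mulA fps_mulC fps_mul1 fps_mulDl fps_one_neq0.

Lemma fpsD a b n : (a + b) n = a n + b n. Proof. by []. Qed.
Lemma fpsN a n : (- a) n = - a n. Proof. by []. Qed.
Lemma fpsB a b n : (a - b) n = a n - b n. Proof. by []. Qed.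
Lemma fps0 n : (0 : fps L) n = 0. Proof. by []. Qed.
Lemma fps1 n : (1 : fps L) n = (n == 0)%N%:R. Proof. by []. Qed.
Lemma fpsM a b n : (a * b) n = \sum_(i < n.+1) a i * b (n - i)%N.
Proof. by []. Qed.
Lemma fps_sum I r (P : pred I) (F : I -> fps L) n :
  (\sum_(i <- r | P i) F i) n = \sum_(i <- r | P i) F i n.
Proof. by apply: (big_morph (fun a : fps L => a n)). Qed.

Lemma ps_expE a n : ps_exp a n = a ^+ n :> fps L.
Proof. by elim: n => [|n IH] //; rewrite exprS -IH. Qed.

Definition fC (c : L) : fps L := fun n => c * (n == 0)%N%:R.

Lemma fCM (c : L) a n : (fC c * a) n = c * a n.
Proof.
rewrite fpsM big_ord_recl big1 /fC /= ?subn0 ?mulr1 ?addr0 // => i _.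
by rewrite /= mulr0 mul0r.
Qed.

Fact fC_additive : zmod_morphism fC.
Proof. by move=> c d; apply/funext => n; rewrite fpsB /fC mulrBl. Qed.
Fact fC_multiplicative : monoid_morphism fC.
Proof.
split=> [|c d]; apply/funext => n; first by rewrite /fC mul1r.
by rewrite fCM /fC mulrA.
Qed.
HB.instance Definition _ := GRing.isZmodMorphism.Build L (fps L) fC fC_additive.
HB.instance Definition _ :=
  GRing.isMonoidMorphism.Build L (fps L) fC fC_multiplicative.

Definition fX : fps L := ps_X L.

Lemma fXn k n : (fX ^+ k) n = (n == k)%N%:R.
Proof.
elim: k n => [|k IH] n //; rewrite exprS fpsM.
case: n => [|n]; first by rewrite big_ord1 /= mul0r.
rewrite big_ord_recl big_ord_recl big1 /= ?mul0r ?mul1r ?add0r ?addr0.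
  by rewrite IH /bump /= subSS subn0 eqSS.
by move=> i _; rewrite /= mul0r.
Qed.

Lemma fXnM k a n : (fX ^+ k * a) n = if (n < k)%N then 0 else a (n - k)%N.
Proof.
rewrite fpsM; case: ltnP => nk.
  rewrite big1 // => i _; rewrite fXn.
  by case: eqP (ltn_ord i) => [->|]; rewrite ?mul0r //; lia.
rewrite (bigD1 (inord k : 'I_n.+1)) //= fXn inordK ?ltnS // eqxx mul1r.
rewrite big1 ?addr0 // => i neq; rewrite fXn; case: eqP; rewrite ?mul0r // => eik.
by case/eqP: neq; apply: val_inj; rewrite /= inordK.
Qed.

(** Congruence modulo [x ^ k]; [eqm k a 0] expresses that [a] has order at least [k]. *)
Definition eqm k a b := forall i, (i < k)%N -> a i = b i.

Lemma eqm_refl k a : eqm k a a. Proof. by []. Qed.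
Lemma eqm_trans k b a c : eqm k a b -> eqm k b c -> eqm k a c.
Proof. by move=> ab bc i ik; rewrite ab ?bc. Qed.
Lemma eqmW k l a b : (k <= l)%N -> eqm l a b -> eqm k a b.
Proof. by move=> kl ab i ik; apply: ab; lia. Qed.
Lemma eqmM k a a' b b' : eqm k a a' -> eqm k b b' -> eqm k (a * b) (a' * b').
Proof.
move=> ha hb i ik; rewrite !fpsM; apply: eq_bigr => j _.
by rewrite ha ?hb //; have := ltn_ord j; lia.
Qed.
Lemma eqmX k n a b : eqm k a b -> eqm k (a ^+ n) (b ^+ n).
Proof.
move=> ab; elim: n => [|n IH]; first exact: eqm_refl.
by rewrite !exprS; apply: eqmM.
Qed.
Lemma eqm_subr0 k a b : eqm k a b -> eqm k (a - b) 0.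
Proof. by move=> ab i ik; rewrite fpsB ab ?subrr. Qed.
Lemma eqm_subr0_inv k a b : eqm k (a - b) 0 -> eqm k a b.
Proof. by move=> ab i ik; apply/eqP; rewrite -subr_eq0 -fpsB ab. Qed.

Definition fshift k a : fps L := fun n => a (n + k)%N.

Lemma fshiftK k a : eqm k a 0 -> a = fX ^+ k * fshift k a.
Proof.
move=> a0; apply/funext => n; rewrite fXnM; case: ltnP => [/a0 //|kn].
by rewrite /fshift subnK.
Qed.

Lemma eqm_fXn k : eqm k (fX ^+ k) 0.
Proof. by move=> i ik; rewrite fXn ltn_eqF. Qed.

Lemma coef_fXnM k a n : (fX ^+ k * a) (k + n)%N = a n.
Proof. by rewrite fXnM ltnNge leq_addr addKn. Qed.

Lemma eqm0M k l a b : eqm k a 0 -> eqm l b 0 -> eqm (k + l) (a * b) 0.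
Proof.
move=> /fshiftK -> /fshiftK -> i ikl.
by rewrite mulrACA -exprD fXnM ikl.
Qed.

Lemma coef0M k l a b : eqm k a 0 -> eqm l b 0 -> (a * b) (k + l)%N = a k * b l.
Proof.
move=> /fshiftK ea /fshiftK eb; rewrite ea eb mulrACA -exprD.
by rewrite !fXnM !ltnn !subnn fpsM big_ord1 subn0.
Qed.

Lemma eqm0Ml k a b : eqm k a 0 -> eqm k (a * b) 0.
Proof. by move=> a0; rewrite -(addn0 k); apply: eqm0M. Qed.

Lemma coef0Ml k a b : eqm k a 0 -> (a * b) k = a k * b 0%N.
Proof. by move=> a0; rewrite -(coef0M (l := 0) a0) ?addn0. Qed.

Lemma coefM0 a b : (a * b) 0%N = a 0%N * b 0%N.
Proof. by rewrite fpsM big_ord1. Qed.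

Lemma coefX0 a n : (a ^+ n) 0%N = a 0%N ^+ n.
Proof. by elim: n => [|n IH] //; rewrite !exprS coefM0 IH. Qed.

Lemma eqm0X n a : a 0%N = 0 -> eqm n (a ^+ n) 0.
Proof.
move=> a0; elim: n => [|n IH]; first by [].
rewrite exprS -add1n; apply: eqm0M IH.
by move=> [].
Qed.

Lemma coef0X n a : a 0%N = 0 -> (a ^+ n) n = a 1%N ^+ n.
Proof.
move=> a0; elim: n => [|n IH] //.
rewrite !exprS -(add1n n) coef0M ?IH //; last exact: eqm0X.
by move=> [].
Qed.

(** In [a ^ n - b ^ n = (a - b) (a ^ n.-1 + ... + b ^ n.-1)] the first factor has order [k], so only
    the constant term of the second one counts; [0 < k] makes [a] and [b] agree there. *)
Lemma coef_exprB k n a b : (0 < k)%N -> eqm k a b ->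
  (a ^+ n) k - (b ^+ n) k = n%:R * b 0%N ^+ n.-1 * (a k - b k).
Proof.
move=> k0 ab; elim: n => [|n IH]; first by rewrite subrr !mul0r.
have a0 : a 0%N = b 0%N by apply: ab.
rewrite -fpsB !exprS.
have -> : a * a ^+ n - b * b ^+ n = (a - b) * a ^+ n + (a ^+ n - b ^+ n) * b by ring.
have h1 : eqm k (a - b) 0 by apply: eqm_subr0.
have h2 : eqm k (a ^+ n - b ^+ n) 0 by apply/eqm_subr0/eqmX.
rewrite fpsD !coef0Ml // coefX0 !fpsB IH a0 /=.
case: n {IH h2} => [|n]; first by rewrite expr0; ring.
by rewrite /= exprS -[in RHS](natr1 n.+1); ring.
Qed.

Lemma fps_cancel a b : a 0%N != 0 -> a * b = 0 -> b = 0.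
Proof.
move=> a0 ab; suff H n : eqm n b 0 by apply/funext => n; apply: (H n.+1).
elim: n => [|n IH] // i; rewrite ltnS leq_eqVlt => /orP[/eqP ->|/IH //].
have h0 : eqm 0 a 0 by [].
have := congr1 (fun c : fps L => c (0 + n)%N) ab.
by rewrite coef0M // => /eqP; rewrite mulf_eq0 (negbTE a0) => /eqP.
Qed.

End FpsRing.
Arguments fX {L}.
Arguments eqm_fXn {L} k.
Arguments eqm_refl {L} k a.

(** * Composition, derivation and formal fixed points *)

Section FpsComposition.
Variable L : fieldType.
Implicit Types a b c u v : fps L.

Definition fcomp a b : fps L := ps_comp a b.

(** The bound [N] is free because [b ^ i] has no term below degree [i]; one range for all degrees
    allows sums to be exchanged. *)
Lemma fcompE N a b n : b 0%N = 0 -> (n <= N)%N ->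
  fcomp a b n = \sum_(i < N.+1) a i * (b ^+ i) n.
Proof.
move=> b0 nN; rewrite /fcomp /ps_comp.
rewrite (big_ord_widen N.+1 (fun i => a i * ps_exp b i n)) // big_mkcond /=.
apply: eq_bigr => i _; rewrite ps_expE; case: ltnP => // ni.
by rewrite (eqm0X b0) // mulr0.
Qed.

Lemma eqm_fcomp_sum a b n : b 0%N = 0 ->
  eqm n.+1 (fcomp a b) (\sum_(i < n.+1) fC (a i) * b ^+ i).
Proof.
move=> b0 k kn; rewrite (@fcompE n) // fps_sum.
by apply: eq_bigr => i _; rewrite fCM.
Qed.

Lemma eqm_fcompl k a a' b : eqm k a a' -> eqm k (fcomp a b) (fcomp a' b).
Proof.
move=> aa n nk; apply: eq_bigr => i _; rewrite aa //.
by have := ltn_ord i; lia.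
Qed.

Lemma eqm_fcompr k a b b' : eqm k b b' -> eqm k (fcomp a b) (fcomp a b').
Proof.
by move=> bb n nk; apply: eq_bigr => i _; rewrite !ps_expE (eqmX _ bb).
Qed.

Lemma fcompD a a' b : fcomp (a + a') b = fcomp a b + fcomp a' b.
Proof.
apply/funext => n; rewrite fpsD /fcomp /ps_comp -big_split.
by apply: eq_bigr => i _; rewrite fpsD mulrDl.
Qed.

Lemma fcompN a b : fcomp (- a) b = - fcomp a b.
Proof.
apply/funext => n; rewrite fpsN /fcomp /ps_comp -sumrN.
by apply: eq_bigr => i _; rewrite fpsN mulNr.
Qed.

Lemma fcompB a a' b : fcomp (a - a') b = fcomp a b - fcomp a' b.
Proof. by rewrite fcompD fcompN. Qed.

Lemma fcompC (c : L) b : fcomp (fC c) b = fC c.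
Proof.
apply/funext => n; rewrite /fcomp /ps_comp big_ord_recl /= big1 ?addr0.
  by rewrite /fC mulr1.
by move=> i _; rewrite /= /fC mulr0 mul0r.
Qed.

Lemma fcomp1 b : fcomp 1 b = 1.
Proof. by rewrite -(rmorph1 (@fC L)) fcompC. Qed.

Lemma fcompX b : b 0%N = 0 -> fcomp fX b = b.
Proof.
move=> b0; apply/funext => n; rewrite (@fcompE n.+1) //.
rewrite big_ord_recl big_ord_recl big1 /= ?mul0r ?add0r ?mul1r ?addr0 //.
by move=> i _; rewrite mul0r.
Qed.

Lemma fcomp_fX a : fcomp a fX = a.
Proof.
apply/funext => n; rewrite (@fcompE n) // (bigD1 ord_max) //= fXn eqxx mulr1.
rewrite big1 ?addr0 // => i /eqP neq; rewrite fXn; case: eqP; rewrite ?mulr0 //.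
by move=> e; case: neq; apply: val_inj.
Qed.

Lemma fcomp_0 a b : fcomp a b 0%N = a 0%N.
Proof. by rewrite /fcomp /ps_comp big_ord1 /= mulr1. Qed.

Lemma fcomp_1 a b : b 0%N = 0 -> fcomp a b 1%N = a 1%N * b 1%N.
Proof.
move=> b0; rewrite (@fcompE 1%N) // !big_ord_recl big_ord0 /= expr0 expr1.
by rewrite mulr0 add0r addr0.
Qed.

(** Modulo [x ^ N.+1] composition is the evaluation of a polynomial, from which it inherits
    multiplicativity. *)
Definition fev (p : {poly L}) b : fps L := (map_poly (@fC L) p).[b].

Lemma coef_fev p b n : b 0%N = 0 ->
  fev p b n = \sum_(i < n.+1) p`_i * (b ^+ i) n.
Proof.
move=> b0; pose N := maxn n.+1 (size p).
rewrite /fev (@horner_coef_wide _ N); last first.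
  by apply: leq_trans (size_poly _ _) _; rewrite leq_maxr.
rewrite fps_sum (big_ord_widen N (fun i => p`_i * (b ^+ i) n)) ?leq_maxl //.
rewrite [RHS]big_mkcond /=; apply: eq_bigr => i _.
rewrite coef_map_id0 ?rmorph0 // fCM; case: ltnP => // ni.
by rewrite (eqm0X b0) // mulr0.
Qed.

Lemma eqm_fev N a b : b 0%N = 0 -> eqm N.+1 (fcomp a b) (fev (fps_trunc N a) b).
Proof.
move=> b0 n nN; rewrite coef_fev // (@fcompE n) //; apply: eq_bigr => i _.
by rewrite coef_fps_trunc //; have := ltn_ord i; lia.
Qed.

Lemma fcompM a a' b : b 0%N = 0 -> fcomp (a * a') b = fcomp a b * fcomp a' b.
Proof.
move=> b0; apply/funext => n.
rewrite (eqmM (eqm_fev (N := n) a b0) (eqm_fev (N := n) a' b0)) //.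
rewrite /fev -hornerM -rmorphM -/(fev _ _) coef_fev // (@fcompE n) //.
apply: eq_bigr => i _; rewrite coef_fps_truncM //.
by rewrite -ltnS.
Qed.

Lemma fcomp_exp a b n : b 0%N = 0 -> fcomp (a ^+ n) b = fcomp a b ^+ n.
Proof.
move=> b0; elim: n => [|n IH]; first exact: fcomp1.
by rewrite !exprS fcompM ?IH.
Qed.

Lemma fcompA a b c : b 0%N = 0 -> c 0%N = 0 ->
  fcomp (fcomp a b) c = fcomp a (fcomp b c).
Proof.
move=> b0 c0; apply/funext => n.
have bc0 : fcomp b c 0%N = 0 by rewrite fcomp_0.
rewrite (@fcompE n) // (@fcompE n a) //.
under eq_bigr => j _ do rewrite (@fcompE n a b j b0 (ltn_ord j)) big_distrl /=.
rewrite exchange_big /=; apply: eq_bigr => i _.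
rewrite -fcomp_exp // (@fcompE n) // big_distrr /=.
by apply: eq_bigr => j _; rewrite mulrA.
Qed.

Definition fder a : fps L := fun n => n.+1%:R * a n.+1.

Lemma fderD a b : fder (a + b) = fder a + fder b.
Proof. by apply/funext => n; rewrite fpsD /fder fpsD mulrDr. Qed.

Lemma fderN a : fder (- a) = - fder a.
Proof. by apply/funext => n; rewrite fpsN /fder fpsN mulrN. Qed.

Lemma fderM a b : fder (a * b) = fder a * b + a * fder b.
Proof.
apply/funext => n; rewrite fpsD /fder !fpsM big_distrr /=.
transitivity (\sum_(i < n.+2) (i%:R * a i * b (n.+1 - i)%N +
                 a i * ((n.+1 - i)%:R * b (n.+1 - i)%N))).
  apply: eq_bigr => i _.
  have {1}-> : n.+1%:R = i%:R + (n.+1 - i)%:R :> L.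
    by rewrite -natrD subnKC // -ltnS.
  by ring.
rewrite big_split /=; congr (_ + _).
  rewrite big_ord_recl /= !mul0r add0r.
  by apply: eq_bigr => i _.
rewrite big_ord_recr /= subnn mul0r mulr0 addr0.
apply: eq_bigr => i _; rewrite subSn //.
by rewrite -ltnS.
Qed.

Lemma fderC (c : L) : fder (fC c) = 0.
Proof. by apply/funext => n; rewrite /fder /fC !mulr0. Qed.

Lemma fder_natM a n : fder (n%:R * a) = n%:R * fder a.
Proof. by rewrite -(rmorph_nat (@fC L)) fderM fderC mul0r add0r. Qed.

Lemma fder1 : fder 1 = 0 :> fps L.
Proof. by rewrite -(rmorph1 (@fC L)) fderC. Qed.

Lemma fder_exp a n : fder (a ^+ n) = n%:R * a ^+ n.-1 * fder a.
Proof.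
elim: n => [|n IH]; first by rewrite !mul0r expr0 -(rmorph1 (@fC L)) fderC.
rewrite exprS fderM IH /= -[n.+1%:R]natr1; case: n {IH} => [|n].
  by rewrite expr0; ring.
by rewrite /= exprS; ring.
Qed.

Lemma fder_fX : fder fX = 1 :> fps L.
Proof. by apply/funext => n; rewrite /fder /=; case: n => [|n]; rewrite ?mulr1 ?mulr0. Qed.

Lemma eqm_fder k a b : eqm k.+1 a b -> eqm k (fder a) (fder b).
Proof. by move=> ab i ik; rewrite /fder ab. Qed.

Lemma fder_comp a b : b 0%N = 0 -> fder (fcomp a b) = fcomp (fder a) b * fder b.
Proof.
move=> b0; apply/funext => n.
rewrite (eqmM (eqm_fcomp_sum (n := n) (fder a) b0) (eqm_refl n.+1 (fder b))) //.
rewrite mulr_suml fps_sum /fder (@fcompE n.+1) // big_distrr /=.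
rewrite big_ord_recl /= mulr0 mulr0 add0r; apply: eq_bigr => i _.
have := congr1 (fun c : fps L => c n) (fder_exp b i.+1).
rewrite /= {1}/fder => e; rewrite mulrCA e -mulrA -mulrA fCM.
rewrite -(rmorph_nat (@fC L)) fCM.
by rewrite mulrA [a _ * _]mulrC.
Qed.

(** Contraction for the [x]-adic distance. Coefficient [n] of the limit is that of iterate [n.+1],
    so a coefficientwise predicate [P] passes to the limit without any closedness. *)
Lemma fps_fixpoint (P : nat -> L -> Prop) (Phi : fps L -> fps L) a0 :
  (forall n, P n (a0 n)) ->
  (forall a, (forall n, P n (a n)) -> forall n, P n (Phi a n)) ->
  (forall k a b, (forall n, P n (a n)) -> (forall n, P n (b n)) ->
     eqm k a b -> eqm k.+1 (Phi a) (Phi b)) ->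
  exists2 w, forall n, P n (w n) & Phi w = w.
Proof.
move=> Pa0 PPhi contr; pose u k := iter k Phi a0.
have Pu k n : P n (u k n).
  by elim: k n => [|k IH] n; [exact: Pa0 | exact: PPhi].
have uS k : eqm k (u k) (u k.+1).
  by elim: k => [|k IH] //; apply: (contr k (u k) (u k.+1)).
have uD k j : eqm k (u k) (u (k + j)%N).
  elim: j => [|j IH]; first by rewrite addn0.
  by apply: eqm_trans IH _; rewrite addnS; apply: eqmW (uS _); apply: leq_addr.
pose w : fps L := fun n => u n.+1 n.
have wu k : eqm k w (u k).
  by move=> n nk; rewrite /w (uD n.+1 (k - n.+1)%N) // subnKC.
have Pw n : P n (w n) by exact: Pu.
exists w => //; apply/funext => n.
by rewrite (contr n w (u n)).
Qed.

(** Since [a] starts in degree 2, only [b ^ i - b' ^ i] with [i >= 2] matter, and these gain a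
    degree: the factor [b' 0 ^ i.-1] in [coef_exprB] is zero. *)
Lemma eqmS_fcomp k a b b' : a 0%N = 0 -> a 1%N = 0 -> b 0%N = 0 -> b' 0%N = 0 ->
  eqm k b b' -> eqm k.+1 (fcomp a b) (fcomp a b').
Proof.
move=> a0 a1 b0 b'0 bb n; rewrite ltnS leq_eqVlt => /orP[/eqP ->|]; last first.
  exact: eqm_fcompr.
rewrite !(@fcompE k) //; apply: eq_bigr => -[[|[|i]] ik] _ /=.
- by rewrite a0 !mul0r.
- by rewrite a1 !mul0r.
case: k bb ik => [|k] bb ik; first by rewrite !coefX0 b0 b'0.
congr (_ * _); apply/eqP; rewrite -subr_eq0 coef_exprB //.
by rewrite b'0 /= exprS mul0r mulr0 mul0r.
Qed.

End FpsComposition.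

(** * Leading terms, Julia's operator and formal invariants *)

Section FormalConjugacy.
Variable L : fieldType.
Hypothesis char0 : forall n, n.+1%:R != 0 :> L.
Implicit Types a b c u v F : fps L.

Lemma natr_inj0 m n : m%:R = n%:R :> L -> m = n.
Proof.
wlog mn : m n / (m <= n)%N => [H e|].
  by case: (leqP m n) => [/H->|/ltnW/H->].
move=> /esym/eqP; rewrite -subr_eq0 -natrB //.
case E: (n - m)%N => [|k]; last by rewrite (negbTE (char0 k)).
by move: E; lia.
Qed.

Lemma coef_exp_tangent d F n : (0 < d)%N -> F 0%N = 0 -> eqm d.+1 F fX ->
  eqm (n + d) (F ^+ n - fX ^+ n) 0 /\ (F ^+ n - fX ^+ n) (n + d)%N = n%:R * F d.+1.
Proof.
move=> d0 F0 FX; have F1 : F 1%N = 1 by rewrite FX.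
pose b := fshift 1 F.
have Fb : F = fX * b by rewrite -[fX]expr1; apply: fshiftK; case.
have b1 : eqm d b 1.
  by move=> i id; rewrite /b /fshift addn1 FX.
have -> : F ^+ n - fX ^+ n = fX ^+ n * (b ^+ n - 1) by rewrite Fb exprMn; ring.
have bn1 : eqm d (b ^+ n - 1) 0.
  by apply: eqm_subr0; have := eqmX n b1; rewrite expr1n.
split; first exact: eqm0M (eqm_fXn n) bn1.
rewrite coef_fXnM fpsB; have := coef_exprB n d0 b1; rewrite expr1n => ->.
rewrite !fps1 expr1n /b /fshift addn1 mulr1; congr (_ * _).
by case: d d0 {FX b1 bn1} => [|d] //=; rewrite subr0.
Qed.

(** Write [z = x ^ n s]: the difference [s o F - s] has order above [d], so degree [n + d] only sees
    the change of [x ^ n] into [F ^ n]. *)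
Lemma coef_comp_tangent d F n z : (0 < d)%N -> F 0%N = 0 -> eqm d.+1 F fX ->
  eqm n z 0 ->
  eqm (n + d) (fcomp z F - z) 0 /\
  (fcomp z F - z) (n + d)%N = n%:R * F d.+1 * z n.
Proof.
move=> d0 F0 FX /fshiftK; set s := fshift n z => ez.
have [e1 e2] := coef_exp_tangent n d0 F0 FX.
have -> : fcomp z F - z =
    (F ^+ n - fX ^+ n) * fcomp s F + fX ^+ n * (fcomp s F - s).
  by rewrite ez fcompM // fcomp_exp // fcompX //; ring.
have sFs : eqm d.+1 (fcomp s F - s) 0.
  by apply: eqm_subr0; rewrite -{2}[s]fcomp_fX; apply: eqm_fcompr.
have h : eqm (n + d).+1 (fX ^+ n * (fcomp s F - s)) 0.
  by rewrite -addnS; apply: eqm0M (eqm_fXn n) sFs.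
split=> [i ind|]; rewrite fpsD.
  by rewrite h ?addr0 ?(eqm0Ml _ e1) //; lia.
rewrite h // addr0 (coef0Ml _ e1) e2 fcomp_0.
by rewrite ez fXnM ltnn subnn.
Qed.

(* The operator whose kernel is the space of vector fields [z d/dx] invariant
   under [F] (Julia's equation). *)
Definition julia F z := fder F * z - fcomp z F.

Lemma juliaB F a b : julia F (a - b) = julia F a - julia F b.
Proof. by rewrite /julia fcompB; ring. Qed.

(** The term [F' z] contributes [(d + 1) F_(d+1) z_n] and the composition [n F_(d+1) z_n]. When
    [F_(d+1)] is nonzero they cancel only for [n = d + 1]: this is the order of an invariant field,
    whose leading coefficient determines the others. *)
Lemma coef_julia d F n z : (0 < d)%N -> F 0%N = 0 -> eqm d.+1 F fX ->
  eqm n z 0 ->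
  eqm (n + d) (julia F z) 0 /\
  julia F z (n + d)%N = (d.+1%:R - n%:R) * F d.+1 * z n.
Proof.
move=> d0 F0 FX z0.
have [e1 e2] := coef_comp_tangent d0 F0 FX z0.
have -> : julia F z = (fder F - 1) * z - (fcomp z F - z) by rewrite /julia; ring.
have F1 : eqm d (fder F - 1) 0.
  by apply: eqm_subr0; rewrite -(fder_fX L); apply: eqm_fder.
split=> [i ii|]; first by rewrite fpsB e1 // subr0 (eqm0M F1 z0) // addnC.
rewrite fpsB e2 {1}[(n + d)%N]addnC coef0M // fpsB fps1 /fder.
by case: d d0 {FX e1 e2 F1} => // d _ /=; ring.
Qed.

(** If [y1] and [y2] first differ in degree [n + 1], with [D = y1 - y2], the leading parts of the
    two sides are [(n + 1) D_(n+1)] and [(d + 1) D_(n+1)]. They clash unless [n = d], so the initial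
    data must include degree [d + 1], a free parameter like the time of a flow. *)
Lemma ode_unique d u v (y1 y2 : fps L) : (0 < d)%N ->
  eqm d.+2 u (fX ^+ d.+1) -> eqm d.+2 v (fX ^+ d.+1) ->
  y1 0%N = 0 -> y1 1%N = 1 -> eqm d.+2 y1 y2 ->
  fder y1 * v = fcomp u y1 -> fder y2 * v = fcomp u y2 -> y1 = y2.
Proof.
move=> d0 uX vX y10 y11 y12 e1 e2.
have y20 : y2 0%N = 0 by rewrite -y12.
have y21 : y2 1%N = 1 by rewrite -y12.
have lowX (z : fps L) : eqm d.+2 z (fX ^+ d.+1) -> eqm d.+1 z 0 /\ z d.+1 = 1.
  move=> zX; split=> [i id|]; rewrite zX ?fXn ?eqxx //; last by lia.
  by case: eqP => //; lia.
have [v0 v1] := lowX _ vX; have [u0 u1] := lowX _ uX.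
suff H n : eqm n.+1 y1 y2 by apply/funext => n; apply: (H n).
elim: n => [|n IH]; first by move=> [|] //= _; rewrite y10.
have [le|lt] := leqP n.+2 d.+2; first exact: eqmW y12.
move=> i; rewrite ltnS leq_eqVlt => /orP[/eqP ->{i}|]; last exact: IH.
pose D := y1 - y2; have D0 : eqm n.+1 D 0 by apply: eqm_subr0.
have eD : fder D * v = fcomp u y1 - fcomp u y2.
  by rewrite -e1 -e2 /D fderD fderN; ring.
have lhs : (fder D * v) (n + d.+1)%N = n.+1%:R * D n.+1.
  rewrite coef0M //; first by rewrite v1 mulr1.
  by have := eqm_fder D0; rewrite /fder => h i /h ->; rewrite mulr0.
pose U := fshift d.+1 u; have eu : u = fX ^+ d.+1 * U by apply: fshiftK.
pose b1 := fshift 1 y1; pose b2 := fshift 1 y2.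
have yb1 : y1 = fX * b1 by rewrite -[fX]expr1; apply: fshiftK; case.
have yb2 : y2 = fX * b2 by rewrite -[fX]expr1; apply: fshiftK; case.
have b12 : eqm n b1 b2 by move=> i id; rewrite /b1 /b2 /fshift IH //; lia.
have n0 : (0 < n)%N by lia.
have eu12 : fcomp u y1 - fcomp u y2 =
   fX ^+ d.+1 * ((b1 ^+ d.+1 - b2 ^+ d.+1) * fcomp U y1
      + b2 ^+ d.+1 * (fcomp U y1 - fcomp U y2)).
  rewrite eu !fcompM // !fcomp_exp // !fcompX //.
  by rewrite {1}yb1 {1}yb2 !exprMn; ring.
have U12 : eqm n.+1 (fcomp U y1 - fcomp U y2) 0.
  by apply: eqm_subr0; apply: eqm_fcompr.
have bb : eqm n (b1 ^+ d.+1 - b2 ^+ d.+1) 0 by apply/eqm_subr0/eqmX.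
have h1 : (b2 ^+ d.+1 * (fcomp U y1 - fcomp U y2)) n = 0.
  by rewrite mulrC; apply: eqm0Ml U12 _ _.
have h2 : ((b1 ^+ d.+1 - b2 ^+ d.+1) * fcomp U y1) n = d.+1%:R * D n.+1.
  rewrite coef0Ml // fpsB coef_exprB // fcomp_0.
  by rewrite /U /b1 /b2 /fshift u1 !add0n y21 expr1n !mulr1 addn1.
have := congr1 (fun c : fps L => c (n + d.+1)%N) eD.
rewrite lhs eu12 {1}addnC coef_fXnM fpsD h1 h2 addr0 => /eqP.
rewrite -subr_eq0 -mulrBl mulf_eq0 subr_eq0 => /orP[/eqP/natr_inj0|]; first by lia.
by rewrite /D fpsB subr_eq0 => /eqP.
Qed.

Definition fnormal m (mu : L) : fps L := fX + fX ^+ m + fC mu * fX ^+ (2 * m - 1).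

Lemma fnormalE m mu : ps_normal m mu = fnormal m mu.
Proof.
apply/funext => n; rewrite /fnormal !fpsD fCM !fXn /ps_normal.
by rewrite -[fX]expr1 fXn.
Qed.

Lemma fnormal_eqm m mu : (1 < m)%N -> eqm m (fnormal m mu) fX.
Proof.
move=> m1 i im; rewrite /fnormal !fpsD fCM !fXn.
have -> : (i == m) = false by lia.
have -> : (i == 2 * m - 1)%N = false by lia.
by rewrite mulr0 !addr0.
Qed.

Lemma fnormal_m m mu : (1 < m)%N -> fnormal m mu m = 1.
Proof.
move=> m1; rewrite /fnormal !fpsD fCM !fXn eqxx -[fX]expr1 fXn.
have -> : (m == 1)%N = false by lia.
have -> : (m == 2 * m - 1)%N = false by lia.
by rewrite mulr0 add0r addr0.
Qed.

(** Different roots [lambda] are allowed, hence [p] may have any linear coefficient [eta != 0]. The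
    leading terms of [p o N - p] and [N' o p - p] give [m' = m] and [eta ^ m.-1 = 1]. In degree
    [j + m.-1] the coefficient [p_j] occurs with factors [j] and [m]: it vanishes for [1 < j < m],
    and for [j = m] it drops out, leaving [mu' = mu]. *)
Lemma normal_form_invariants m m' mu mu' (p : fps L) :
  (1 < m)%N -> (1 < m')%N -> p 0%N = 0 -> p 1%N != 0 ->
  fcomp p (fnormal m mu) = fcomp (fnormal m' mu') p -> m' = m /\ mu' = mu.
Proof.
move=> m1 m'1 p0 p1 e; set eta := p 1%N in p1.
have eN' : fcomp (fnormal m' mu') p - p = p ^+ m' + fC mu' * p ^+ (2 * m' - 1).
  rewrite /fnormal !fcompD fcompM // !fcomp_exp // !fcompX // fcompC; ring.
have N0 : fnormal m mu 0%N = 0 by rewrite fnormal_eqm //; lia.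
have NX : eqm m.-1.+1 (fnormal m mu) fX by rewrite prednK; [exact: fnormal_eqm | lia].
have d0 : (0 < m.-1)%N by lia.
have Nm : fnormal m mu m.-1.+1 = 1 by rewrite prednK ?fnormal_m //; lia.
have p01 : eqm 1 p 0 by case.
have [l1 l2] := coef_comp_tangent d0 N0 NX p01.
rewrite Nm !mul1r e eN' in l1 l2.
have em : (1 + m.-1 = m)%N by lia.
rewrite em in l1 l2.
have p2 : eqm m'.+1 (fC mu' * p ^+ (2 * m' - 1)) 0.
  by move=> i im; rewrite fCM (eqm0X p0) ?mulr0 //; lia.
have [lt|lt|eq] := ltngtP m m'.
- move: l2; rewrite fpsD p2 ?addr0 ?(eqm0X p0) //; last by lia.
  by move=> e0; rewrite /eta -e0 eqxx in p1.
- have := l1 _ lt; rewrite fpsD p2 // addr0 coef0X // => /eqP.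
  by rewrite expf_eq0 (negbTE p1) andbF.
subst m'; split=> //.
have etam : eta ^+ m = eta by move: l2; rewrite fpsD p2 // addr0 coef0X.
have etam1 : eta ^+ m.-1 = 1.
  by apply: (mulfI p1); rewrite mulr1 -exprS prednK //; lia.
have key j : (1 < j <= m)%N -> eqm j p (fC eta * fX) ->
    j%:R * p j + eta * mu * (j == m)%:R =
    m%:R * p j + mu' * eta * (j == m)%:R.
  move=> /andP[j1 jm] pj; pose s := p - fC eta * fX.
  have s0 : eqm j s 0 by apply: eqm_subr0.
  have sj : s j = p j.
    rewrite /s fpsB fCM -[fX]expr1 fXn; have -> : (j == 1)%N = false by lia.
    by rewrite mulr0 subr0.
  have [_ k2] := coef_comp_tangent d0 N0 NX s0.
  have eL : fcomp p (fnormal m mu) - p =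
      fC eta * (fnormal m mu - fX) + (fcomp s (fnormal m mu) - s).
    by rewrite /s fcompB fcompM // fcompC fcompX //; ring.
  have := congr1 (fun c : fps L => c (j + m.-1)%N) eL.
  rewrite e eN' fpsD fpsD k2 Nm mulr1 sj !fCM.
  have -> : (fnormal m mu - fX) (j + m.-1)%N = mu * (j == m)%:R.
    rewrite /fnormal fpsB !fpsD fCM !fXn -[fX]expr1 fXn.
    have -> : (j + m.-1 == m)%N = false by lia.
    have -> : (j + m.-1 == 2 * m - 1)%N = (j == m) by lia.
    by rewrite addr0 addrAC subrr add0r.
  pose q := fshift 1 p.
  have pq : p = fX * q by rewrite -[fX]expr1; apply: fshiftK; case.
  have qe : eqm j.-1 q (fC eta).
    move=> i ij; rewrite /q /fshift pj ?fCM ?addn1; last by lia.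
    by rewrite -[fX]expr1 fXn /fC.
  have -> : (p ^+ m) (j + m.-1)%N = m%:R * p j.
    have -> : (j + m.-1 = m + j.-1)%N by lia.
    rewrite pq exprMn coef_fXnM -pq; have j0 : (0 < j.-1)%N by lia.
    have := coef_exprB m j0 qe; rewrite -rmorphXn /= /fC.
    have -> : (j.-1 == 0)%N = false by lia.
    rewrite eqxx !mulr0 !subr0 mulr1 etam1 mulr1 => ->.
    by rewrite /q /fshift addn1 prednK //; lia.
  have -> : (p ^+ (2 * m - 1)) (j + m.-1)%N = eta * (j == m)%:R.
    case: eqP => [->|jm'].
      have -> : (m + m.-1 = 2 * m - 1)%N by lia.
      rewrite coef0X // mulr1.
      have -> : (2 * m - 1 = m.-1 + m)%N by lia.
      by rewrite exprD etam1 etam mul1r.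
    by rewrite mulr0 (eqm0X p0) //; lia.
  by rewrite !mulrA => ->; rewrite addrC.
have pj j : (2 <= j <= m)%N -> eqm j p (fC eta * fX).
  case/andP; elim: j => // j IH j1 jm i; rewrite ltnS leq_eqVlt.
  have [j2|j2] := leqP 2 j; last first.
    have -> : j = 1%N by lia.
    by case: i => [|[|i]] // _; rewrite fCM -[fX]expr1 fXn /= ?p0 ?mulr0 ?mulr1.
  move=> /orP[/eqP ->|]; last by apply: IH => //; lia.
  have := @key j; rewrite j2 (ltnW jm) => /(_ isT (IH j2 (ltnW jm)))/eqP.
  rewrite (ltn_eqF jm) !mulr0 !addr0 -subr_eq0 -mulrBl mulf_eq0 subr_eq0.
  case/orP => [/eqP/natr_inj0|/eqP ->]; first by lia.
  rewrite fCM -[fX]expr1 fXn; have -> : (j == 1)%N = false by lia.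
  by rewrite mulr0.
have := @key m; rewrite m1 leqnn eqxx => /(_ isT (pj m _)).
rewrite m1 leqnn !mulr1 => /(_ isT)/addrI; rewrite mulrC => /(mulIf p1) ->.
by [].
Qed.

End FormalConjugacy.

(** * The residue of the invariant field of the normal form *)

Lemma exp_quadratic (A : comNzRingType) (t M : A) n :
  exists q, (1 + t + M * t ^+ 2) ^+ n =
    1 + n%:R * t + (n%:R * M + 'C(n, 2)%:R) * t ^+ 2 + t ^+ 3 * q.
Proof.
elim: n => [|n [q IH]]; first by exists 0; rewrite expr0 bin0n /=; ring.
exists (q * (1 + t + M * t ^+ 2) + n%:R * M + n%:R * M + 'C(n, 2)%:R
  + (n%:R * M + 'C(n, 2)%:R) * M * t).
rewrite exprS IH binS bin1 natrD -[n.+1%:R]natr1; ring.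
Qed.

Section VectorFields.
Variable L : fieldType.
Hypothesis char0 : forall n, n.+1%:R != 0 :> L.
Implicit Types a b c u v F : fps L.

Lemma fX_fder_fXn k : fX * fder (fX ^+ k) = k%:R * fX ^+ k :> fps L.
Proof.
rewrite fder_exp fder_fX mulr1; case: k => [|k]; first by rewrite !mul0r mulr0.
by rewrite /= exprS; ring.
Qed.

(** With [t = x ^ d], Julia's operator sends [v0 = x ^ d.+1 (1 + c t)] to [x ^ d.+1] times a
    polynomial in [t] whose terms in [1] and [t] cancel; [c] is the value that kills the term in
    [t ^ 2]. Then [coef_julia] makes [v - v0] vanish up to degree [2 d + 1], which is far enough for
    the residue. *)
Lemma julia_fnormal d mu v : (0 < d)%N -> eqm d.+2 v (fX ^+ d.+1) ->
  julia (fnormal d.+1 mu) v = 0 ->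
  eqm (2 * d.+1)
    v (fX ^+ d.+1 * (1 + fC (mu - 'C(d.+1, 2)%:R / d%:R) * fX ^+ d)).
Proof.
move=> d0 vX jv; set c := mu - _; set N := fnormal d.+1 mu.
set v0 := _ * (1 + _); pose t : fps L := fX ^+ d.
have m2 : (2 * d.+1 - 1 = (d + d).+1)%N by lia.
have Xt : fX ^+ d.+1 = fX * t by rewrite exprS.
have Xtt : fX ^+ (d + d).+1 = fX * t ^+ 2 by rewrite exprS exprD expr2.
have dt : fX * fder t = d%:R * t by exact: fX_fder_fXn.
have v0E : v0 = fX * t + fC c * (fX * t ^+ 2).
  by rewrite /v0 Xt -/t; ring.
have N0 : N 0%N = 0 by rewrite /N fnormal_eqm.
have NX : eqm d.+1 N fX by apply: fnormal_eqm.
have Nm : N d.+1 = 1 by apply: fnormal_m.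
have Nb : N = fX * (1 + t + fC mu * t ^+ 2).
  by rewrite /N /fnormal m2 Xtt Xt; ring.
have dN : fder N = 1 + d.+1%:R * t + (d + d).+1%:R * fC mu * t ^+ 2.
  rewrite Nb fderM fder_fX !fderD !fderM fderC -(rmorph1 (@fC L)) fderC rmorph1.
  rewrite -[(d + d).+1%:R]natr1 -[d.+1%:R]natr1 natrD; ring: dt.
have [q1 e1] := exp_quadratic t (fC mu) d.+1.
have [q2 e2] := exp_quadratic t (fC mu) (d + d).+1.
have dn0 : d%:R != 0 :> L by rewrite -(prednK d0).
have cE : 'C(d.+1, 2)%:R =
    (d + d).+1%:R * mu + c * d.+1%:R - d.+1%:R * mu - c * (d + d).+1%:R.
  rewrite /c -[(d + d).+1%:R]natr1 -[d.+1%:R]natr1 natrD; field.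
  exact: dn0.
have [Q jv0] : exists Q, julia N v0 = fX ^+ d.+1 * (t ^+ 3 * Q).
  have cE' : 'C(d.+1, 2)%:R = (d + d).+1%:R * fC mu + fC c * d.+1%:R
      - d.+1%:R * fC mu - fC c * (d + d).+1%:R.
    by rewrite -!(rmorph_nat (@fC L)) cE !(rmorphB, rmorphD, rmorphM).
  have -> : julia N v0 = fX ^+ d.+1 * ((1 + fC c * t) * fder N
      - (1 + t + fC mu * t ^+ 2) ^+ d.+1
      - fC c * t * (1 + t + fC mu * t ^+ 2) ^+ (d + d).+1).
    rewrite /julia v0E -Xt -Xtt fcompD fcompM // fcompC !fcomp_exp // fcompX //.
    by move: (fder N) => N'; rewrite Nb !exprMn Xtt Xt; ring.
  exists (- q1 - fC c * 'C((d + d).+1, 2)%:R - fC c * t * q2).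
  by congr (_ * _); rewrite e1 e2 dN cE'; ring.
have jz : julia N (v - v0) = - julia N v0.
  by rewrite juliaB jv sub0r.
have jz0 : eqm (d.+1 + (d + d + d)) (julia N (v - v0)) 0.
  have tQ : eqm (d + d + d) (t ^+ 3 * Q) 0.
    apply: eqm0Ml; rewrite /t -exprM; have -> : (d * 3 = d + d + d)%N by lia.
    exact: eqm_fXn.
  by rewrite jz jv0 => i hi; rewrite fpsN (eqm0M (eqm_fXn d.+1) tQ) ?oppr0.
apply: eqm_subr0_inv.
have key k : (d.+2 + k <= 2 * d.+1)%N -> eqm (d.+2 + k) (v - v0) 0.
  elim: k => [|k IH] hk.
    rewrite addn0; apply: eqm_subr0; apply: eqm_trans vX _.
    rewrite /v0 => i hi; rewrite mulrDr mulr1 fpsD mulrCA fCM -exprD !fXn.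
    have -> : (i == d.+1 + d)%N = false by lia.
    by rewrite mulr0 addr0.
  rewrite addnS => i; rewrite ltnS leq_eqVlt => /orP[/eqP ->{i}|]; last first.
    by apply: IH; lia.
  have kz : eqm (d.+2 + k) (v - v0) 0 by apply: IH; lia.
  have [_] := coef_julia d0 N0 NX kz.
  rewrite jz0 ?Nm ?mulr1; last by lia.
  move/esym/eqP; rewrite mulf_eq0 => /orP[|/eqP //].
  by rewrite subr_eq0 => /eqP/(natr_inj0 char0); lia.
have <- : (d.+2 + d = 2 * d.+1)%N by lia.
by apply: key; lia.
Qed.

End VectorFields.

(** * Linearizing coordinates and conjugation of fields *)

Section Linearization.
Variable L : fieldType.
Hypothesis char0 : forall n, n.+1%:R != 0 :> L.
Implicit Types a b c u v w F V W h : fps L.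

Definition fexp : fps L := fun n => (n`!%:R)^-1.

(* [(1 - exp (- d x)) / d] *)
Definition fexpm d : fps L :=
  fun n => if n is k.+1 then (- d%:R) ^+ k / n`!%:R else 0.

Lemma fact_neq0 n : n`!%:R != 0 :> L.
Proof. by rewrite -(prednK (fact_gt0 n)). Qed.

Lemma fder_fexp : fder fexp = fexp.
Proof.
apply/funext => n; rewrite /fder /fexp factS natrM invfM.
by rewrite mulrA divff ?mul1r.
Qed.

Lemma fder_fexpm d : fder (fexpm d) = 1 - d%:R * fexpm d.
Proof.
apply/funext => n; rewrite -(rmorph_nat (@fC L)) fpsB fCM fps1 /fder /fexpm.
rewrite factS natrM invfM mulrCA [n.+1%:R * _]mulrA divff // mul1r.
case: n => [|n]; first by rewrite expr0 mulr0 subr0 fact0 invr1 mulr1.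
by rewrite exprS sub0r; ring.
Qed.

Lemma fder_eq0 a : fder a = 0 -> a = fC (a 0%N).
Proof.
move=> da; apply/funext => -[|n]; first by rewrite /fC mulr1.
have := congr1 (fun c : fps L => c n) da; rewrite /fder /fC mulr0 => /eqP.
by rewrite mulf_eq0 (negbTE (char0 n)) => /eqP.
Qed.

(* The primitive of [x ^ (- d - 1) (W (x) - W_d x ^ d) dx], times [x ^ d] and up
   to a constant. *)
Definition fprim d (W : fps L) : fps L :=
  fun n => if (n == 0)%N || (n == d) then 0 else W n / (n%:R - d%:R).

(** The operator [x d/dx - d] multiplies degree [n] by [n - d], and [fprim] inverts it except in two
    degrees: [d], whose term integrates to a logarithm, and [0], whose term is moved to the other
    side as the constant of [(1 - exp (- d w)) / d]. *)
Lemma fprimE d W : (0 < d)%N -> W 0%N = 1 ->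
  fX * fder (fprim d W) = d%:R * fprim d W + W - 1 - fC (W d) * fX ^+ d.
Proof.
move=> d0 W0; apply/funext => n.
have -> : (fX * fder (fprim d W)) n = n%:R * fprim d W n.
  case: n => [|n]; first by rewrite coefM0 /= !mul0r.
  by rewrite -[fX]expr1 -(add1n n) coef_fXnM add1n.
rewrite -(rmorph_nat (@fC L)) !fpsB fpsD !fCM fps1 fXn /fprim.
case: eqP => [->|n0] /=.
  by rewrite ltn_eqF // W0 !mulr0 add0r subrr subr0.
case: eqP => [->|nd].
  by rewrite !mulr0 mulr1 add0r subr0 subrr.
rewrite mulr0 !subr0.
have nd0 : n%:R - d%:R != 0 :> L.
  by rewrite subr_eq0; apply/eqP => /(natr_inj0 char0).
by rewrite -[X in _ = _ + X](divfK nd0 (W n)); ring.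
Qed.

(** The claim says [h' (h ^ (- d - 1) + r / h) = x ^ (- d - 1) W] with [r = W_d]. The left side has
    primitive [- h ^ (- d) / d + r log h]; putting [h = x e^w], cancelling [r log x] and multiplying
    by [x ^ d] yields the hypothesis on [w]. *)
Lemma linearize_formal d V W w : (0 < d)%N -> W * V = 1 -> W 0%N = 1 ->
  w 0%N = 0 -> fcomp (fexpm d) w + fC (W d) * fX ^+ d * w = fprim d W ->
  let h := fX * fcomp fexp w in
  fder h * (fX ^+ d.+1 * V) * (1 + fC (W d) * h ^+ d) = h ^+ d.+1.
Proof.
move=> d0 WV W0 w0 ew h; set r := fC (W d) in ew *.
pose E := fcomp fexp w; pose e := 1 - d%:R * fcomp (fexpm d) w.
have dE : fder E = E * fder w by rewrite fder_comp // fder_fexp.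
have de : fder (fcomp (fexpm d) w) = e * fder w.
  rewrite fder_comp // fder_fexpm fcompB fcomp1 -(rmorph_nat (@fC L)).
  by rewrite fcompM // fcompC rmorph_nat.
have Xd : fX * fder (fX ^+ d) = d%:R * fX ^+ d :> fps L by exact: fX_fder_fXn.
(* This is [x d/dx] of the implicit equation, with [e = exp (- d w)]; the factor [1 + x w'] is
   [x h' / h]. *)
have main : (1 + fX * fder w) * (e + r * fX ^+ d) = W.
  have := congr1 (fun a => fX * fder a) ew; rewrite fprimE // -/r -ew.
  rewrite fderD de !fderM fderC => e1.
  have e2 : W = fX * (e * fder w + ((0 * fX ^+ d + r * fder (fX ^+ d)) * w
       + r * fX ^+ d * fder w)) - d%:R * (fcomp (fexpm d) w + r * fX ^+ d * w)
       + 1 + r * fX ^+ d by rewrite e1; ring.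
  rewrite e2 /e; move: Xd; set z := fX ^+ d => Xd.
  ring: Xd.
(* The derivative is zero and the constant term is [1]. *)
have Ee : E ^+ d * e = 1.
  rewrite [LHS]fder_eq0.
    rewrite coefM0 coefX0 /E fcomp_0 /fexp fact0 invr1 expr1n mul1r.
    rewrite /e -(rmorph_nat (@fC L)) fpsB fCM fcomp_0 mulr0 subr0.
    by rewrite rmorph1.
  rewrite fderM fder_exp dE [fder e]fderD fderN fder1 fder_natM de.
  have -> : E ^+ d = E * E ^+ d.-1 by rewrite -exprS prednK.
  by ring.
have dh : fder h = E * (1 + fX * fder w).
  by rewrite /h fderM fder_fX -/E dE; ring.
have -> : 1 + r * h ^+ d = E ^+ d * (e + r * fX ^+ d).
  by rewrite /h -/E exprMn -Ee; ring.
rewrite dh.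
have -> : E * (1 + fX * fder w) * (fX ^+ d.+1 * V) * (E ^+ d * (e + r * fX ^+ d)) =
  E ^+ d.+1 * fX ^+ d.+1 * (V * ((1 + fX * fder w) * (e + r * fX ^+ d))).
  rewrite [E ^+ d.+1]exprS.
  by ring.
by rewrite main [V * W]mulrC WV mulr1 -exprMn [E * _]mulrC.
Qed.

(** Both fields are carried to the same model, by [hF] and [hN]. The common factor
    [(hN' o h) (1 + r hF ^ d)] has constant term [1] and cancels. *)
Lemma conjugate_vector_fields d (r : L) (vF vN hF hN : fps L) h :
  (0 < d)%N -> h 0%N = 0 -> hF 0%N = 0 -> hN 1%N = 1 -> fcomp hN h = hF ->
  fder hF * vF * (1 + fC r * hF ^+ d) = hF ^+ d.+1 ->
  fder hN * vN * (1 + fC r * hN ^+ d) = hN ^+ d.+1 ->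
  fder h * vF = fcomp vN h.
Proof.
move=> d0 h0 hF0 hN1 eh eF eN.
have := congr1 (fun a => fcomp a h) eN.
rewrite !fcompM // fcompD fcomp1 fcompM // fcompC !fcomp_exp // eh -eF -eh.
rewrite fder_comp // eh => e.
apply/eqP; rewrite -subr_eq0; apply/eqP.
apply: (@fps_cancel _ (fcomp (fder hN) h * (1 + fC r * hF ^+ d))).
  rewrite coefM0 fcomp_0 fpsD fCM coefX0 hF0 expr0n /fder hN1 gtn_eqF //.
  by rewrite mulr0 addr0 !mulr1 oner_neq0.
by move/eqP: e; rewrite eq_sym -subr_eq0 => /eqP <-; ring.
Qed.

(** By the two Julia equations, [h o F] and [N o h] both solve [y' vF = vN o y]. As [F] and [N] have
    coefficient [1] in degree [d + 1], the two solutions agree up to that degree, which is what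
    [ode_unique] requires. *)
Lemma conjugate_maps d mu F (vF vN : fps L) h : (0 < d)%N ->
  F 0%N = 0 -> eqm d.+1 F fX -> F d.+1 = 1 -> h 0%N = 0 -> h 1%N = 1 ->
  eqm d.+2 vF (fX ^+ d.+1) -> eqm d.+2 vN (fX ^+ d.+1) ->
  julia F vF = 0 -> julia (fnormal d.+1 mu) vN = 0 ->
  fder h * vF = fcomp vN h ->
  fcomp h F = fcomp (fnormal d.+1 mu) h.
Proof.
move=> d0 F0 FX Fm h0 h1 vFX vNX; rewrite /julia; set N := fnormal _ _.
move=> /subr0_eq jF /subr0_eq jN e.
have N0 : N 0%N = 0 by rewrite /N fnormal_eqm.
have hF0 : fcomp h F 0%N = 0 by rewrite fcomp_0.
have hF1 : fcomp h F 1%N = 1 by rewrite fcomp_1 // h1 FX // mulr1.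
apply: (ode_unique char0 d0 vNX vFX) => //.
- have h01 : eqm 1 h 0 by case.
  have [l1 l2] := coef_comp_tangent d0 F0 FX h01.
  have eN : fcomp N h - h = h ^+ d.+1 + fC mu * h ^+ (2 * d.+1 - 1).
    by rewrite /N /fnormal !fcompD fcompM // !fcomp_exp // !fcompX // fcompC; ring.
  move=> i id; apply: (addIr (- h i)); rewrite -!fpsB eN [RHS]fpsD fCM.
  have -> : (h ^+ (2 * d.+1 - 1)) i = 0 by apply: (eqm0X h0); lia.
  rewrite mulr0 addr0; move: id; rewrite ltnS leq_eqVlt => /orP[/eqP ->|id].
    by rewrite -[d.+1]add1n l2 add1n Fm h1 coef0X // h1 expr1n !mulr1.
  by rewrite (eqm0X h0) ?l1.
- by rewrite fder_comp // -mulrA jF -fcompM // e fcompA.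
- by rewrite fder_comp // -mulrA e -fcompM // jN fcompA.
Qed.

End Linearization.

(** * Ultrametric absolute values and factorials *)

Section NonarchAbs.
Variables (R : realType) (L : fieldType) (abs : L -> R).
Hypothesis absL : nonarch_abs abs.

Lemma nabs_ge0 x : 0 <= abs x. Proof. by case: absL. Qed.
Local Hint Resolve nabs_ge0 : core.
Lemma nabsM x y : abs (x * y) = abs x * abs y. Proof. by case: absL. Qed.
Lemma nabs0 : abs 0 = 0. Proof. by case: absL => _ /(_ 0)[_ ->]. Qed.
Lemma nabs_eq0 x : (abs x == 0) = (x == 0).
Proof. by case: absL => _ /(_ x) h _ _; apply/eqP/eqP => /h. Qed.
Lemma nabs_gt0 x : (0 < abs x) = (x != 0).
Proof. by rewrite lt_def nabs_eq0 nabs_ge0 andbT. Qed.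
Lemma nabs1 : abs 1 = 1.
Proof.
have n1 : abs 1 != 0 by rewrite nabs_eq0 oner_eq0.
by apply: (mulfI n1); rewrite -nabsM !mulr1.
Qed.
Lemma nabsX x n : abs (x ^+ n) = abs x ^+ n.
Proof. by elim: n => [|n IH]; rewrite ?nabs1 // !exprS nabsM IH. Qed.
Lemma nabsN x : abs (- x) = abs x.
Proof.
suff N1 : abs (- 1) = 1 by rewrite -mulN1r nabsM N1 mul1r.
apply/eqP; rewrite -(@eqrXn2 _ 2) // -nabsX.
by rewrite sqrrN expr1n nabs1 expr1n.
Qed.
Lemma nabsV x : abs x^-1 = (abs x)^-1.
Proof.
have [->|x0] := eqVneq x 0; first by rewrite invr0 nabs0 invr0.
have ax0 : abs x != 0 by rewrite nabs_eq0.
by apply: (mulfI ax0); rewrite -nabsM !divff // nabs1.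
Qed.
Lemma nabsD_le x y M : abs x <= M -> abs y <= M -> abs (x + y) <= M.
Proof.
move=> xM yM; case: absL => _ _ _ /(_ x y) h.
by apply: le_trans h _; rewrite ge_max xM.
Qed.
Lemma nabsB_le x y M : abs x <= M -> abs y <= M -> abs (x - y) <= M.
Proof. by move=> xM yM; apply: nabsD_le; rewrite ?nabsN. Qed.
Lemma nabs_sum_le I (r : seq I) (P : pred I) (F : I -> L) M : 0 <= M ->
  (forall i, P i -> abs (F i) <= M) -> abs (\sum_(i <- r | P i) F i) <= M.
Proof.
move=> M0 FM; apply: (big_ind (fun x => abs x <= M)) => //; first by rewrite nabs0.
by move=> x y; apply: nabsD_le.
Qed.
Lemma nabs_nat n : abs n%:R <= 1.
Proof.
elim: n => [|n IH]; first by rewrite nabs0 ler01.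
by rewrite -natr1; apply: nabsD_le; rewrite ?nabs1.
Qed.
Lemma nabs_fact_le i j : (i <= j)%N -> abs j`!%:R <= abs i`!%:R.
Proof.
move=> /subnK <-; elim: (j - i)%N => [|k IH]; first by [].
rewrite addSn factS natrM nabsM; apply: le_trans IH.
by apply: ler_piMl => //; apply: nabs_nat.
Qed.

Hypothesis char0 : forall n, n.+1%:R != 0 :> L.

(* Legendre: if [p] is the least [p > 0] with [|p| < 1], then [|k| = 1] for [k]
   not divisible by [p], so that [|n!| = |p| ^ (n / p) |(n / p)!|]. *)
Lemma nabs_fact_ge : exists2 beta : R, 1 <= beta &
  forall n, (abs n`!%:R)^-1 <= beta ^+ n.
Proof.
have abs_ge1 k : ~~ (abs k%:R < 1) -> abs k%:R = 1.
  by rewrite -leNgt => h; apply: le_anti; rewrite h nabs_nat.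
have [ex|nex] := pselect (exists k, (0 < k)%N && (abs k%:R < 1)); last first.
  exists 1 => // n; rewrite expr1n (_ : abs n`!%:R = 1) ?invr1 //.
  apply: abs_ge1; apply/negP => h; apply: nex; exists n`!.
  by rewrite fact_gt0.
case: (ex_minnP ex) => p /andP[p0 pl1] pmin.
have p1 : (1 < p)%N by case: p p0 pl1 {pmin} => [|[|]] //; rewrite nabs1 ltxx.
have coprime1 k : ~~ (p %| k)%N -> abs k%:R = 1.
  move=> pk; apply: abs_ge1; apply/negP => kl1.
  have km : (0 < k %% p)%N by rewrite lt0n.
  have : abs (k %% p)%:R < 1.
    have -> : (k %% p)%:R = k%:R - (k %/ p)%:R * p%:R :> L.
      by rewrite {2}(divn_eq k p) natrD natrM [_ + (_ %% _)%:R]addrC addrK.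
    apply: (@le_lt_trans _ _ (Num.max (abs k%:R) (abs p%:R))).
      apply: nabsB_le; first by rewrite le_max lexx.
      rewrite nabsM le_max; apply/orP; right.
      by apply: ler_piMl => //; apply: nabs_nat.
    by rewrite gt_max kl1.
  move=> h; have := pmin (k %% p)%N; rewrite km h => /(_ isT).
  by rewrite leqNgt ltn_mod p0.
have legendre n : abs n`!%:R = abs p%:R ^+ (n %/ p) * abs (n %/ p)`!%:R.
  elim: n => [|n IH]; first by rewrite div0n expr0 mul1r.
  rewrite factS natrM nabsM IH divnS //.
  have [pn|pn] /= := boolP (p %| n.+1)%N; last by rewrite coprime1 ?mul1r.
  rewrite add1n factS natrM nabsM exprS.
  have -> : abs n.+1%:R = abs (n %/ p).+1%:R * abs p%:R.
    rewrite -nabsM -natrM; have := divnS n p0; rewrite pn add1n => <-.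
    by rewrite divnK.
  by ring.
have pn0 : 0 < abs p%:R by rewrite nabs_gt0 -(prednK p0).
have b1 : 1 <= (abs p%:R)^-1 by rewrite invf_ge1 // ltW.
exists (abs p%:R)^-1 => // n.
elim/ltn_ind: n => -[|n] IH; first by rewrite fact0 nabs1 invr1 expr0.
rewrite legendre invfM -exprVn.
have qn : (n.+1 %/ p < n.+1)%N by apply: ltn_Pdiv.
(* The explicit factor and the induction hypothesis each cost [n.+1 %/ p] powers, and twice this is
   at most [n.+1] because [p >= 2]. *)
apply: le_trans (_ : _ <= (abs p%:R)^-1 ^+ (n.+1 %/ p) * (abs p%:R)^-1 ^+ (n.+1 %/ p)) _.
  by apply: ler_wpM2l; [rewrite exprn_ge0 ?invr_ge0 | apply: IH].
rewrite -exprD; apply: ler_weXn2l => //.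
have : (n.+1 %/ p * p <= n.+1)%N by rewrite leq_divM.
by nia.
Qed.

End NonarchAbs.

(** * Series with geometrically bounded coefficients *)

Section GeometricSeries.
Variables (R : realType) (L : fieldType) (abs : L -> R) (S : set L).
Hypothesis absL : nonarch_abs abs.
Hypothesis char0 : forall n, n.+1%:R != 0 :> L.

(** To be instantiated by [K[lambda]] inside [Kbar]. Once the leading coefficient of [F] is
    normalized to [1], the constructions divide only by integers. *)
Record rational_subring : Prop := RationalSubring {
  subr_one : S 1;
  subr_sub : forall x y, S x -> S y -> S (x - y);
  subr_mul : forall x y, S x -> S y -> S (x * y);
  subr_natV : forall n, S (n%:R)^-1 }.

Hypothesis Sring : rational_subring.
Implicit Types (a b : fps L) (M r : R).

Let abs_ge0 x : 0 <= abs x. Proof. exact: nabs_ge0 absL x. Qed.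
Local Hint Resolve abs_ge0 : core.

Lemma subr_0 : S 0.
Proof. by rewrite -(subrr 1); apply: subr_sub => //; apply: subr_one. Qed.
Lemma subr_opp x : S x -> S (- x).
Proof. by rewrite -sub0r; apply: subr_sub => //; apply: subr_0. Qed.
Lemma subr_add x y : S x -> S y -> S (x + y).
Proof.
by move=> Sx Sy; rewrite -[y]opprK; apply: subr_sub => //; apply: subr_opp.
Qed.
Lemma subr_sum I (s : seq I) (P : pred I) (F : I -> L) :
  (forall i, P i -> S (F i)) -> S (\sum_(i <- s | P i) F i).
Proof. by move=> SF; apply: big_ind => //; [apply: subr_0|apply: subr_add]. Qed.
Lemma subr_nat n : S n%:R.
Proof.
elim: n => [|n IH]; first exact: subr_0.
by rewrite -natr1; apply: subr_add => //; apply: subr_one.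
Qed.
Lemma subr_exp x n : S x -> S (x ^+ n).
Proof.
move=> Sx; elim: n => [|n IH]; first exact: subr_one.
by rewrite exprS; apply: subr_mul.
Qed.

Definition coef_in a := forall n, S (a n).

Lemma coef_inM a b : coef_in a -> coef_in b -> coef_in (a * b).
Proof. by move=> Sa Sb n; apply: subr_sum => i _; apply: subr_mul. Qed.
Lemma coef_inC (c : L) : S c -> coef_in (fC c).
Proof. by move=> Sc n; apply: subr_mul => //; apply: subr_nat. Qed.
Lemma coef_in1 : coef_in 1. Proof. by move=> n; apply: subr_nat. Qed.
Lemma coef_inX a n : coef_in a -> coef_in (a ^+ n).
Proof.
move=> Sa; elim: n => [|n IH]; first exact: coef_in1.
by rewrite exprS; apply: coef_inM.
Qed.
Lemma coef_in_comp a b : coef_in a -> coef_in b -> coef_in (fcomp a b).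
Proof.
move=> Sa Sb n; apply: subr_sum => i _; apply: subr_mul => //.
by rewrite ps_expE; apply: coef_inX.
Qed.
Lemma coef_in_der a : coef_in a -> coef_in (fder a).
Proof. by move=> Sa n; apply: subr_mul => //; apply: subr_nat. Qed.

Definition fbound M r a := forall n, abs (a n) <= M * r ^+ n.

Lemma fboundM M M' r a b : 0 <= M -> 0 <= M' -> 0 <= r ->
  fbound M r a -> fbound M' r b -> fbound (M * M') r (a * b).
Proof.
move=> M0 M'0 r0 ha hb n; rewrite fpsM; apply: nabs_sum_le => //.
  by rewrite !mulr_ge0 ?exprn_ge0.
move=> i _; rewrite nabsM //.
apply: le_trans (ler_pM (abs_ge0 _) (abs_ge0 _) (ha _) (hb _)) _.
by rewrite mulrACA -exprD subnKC // -ltnS.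
Qed.

Lemma fboundX M r a n : 0 <= M -> 0 <= r -> fbound M r a -> fbound (M ^+ n) r (a ^+ n).
Proof.
move=> M0 r0 ha; elim: n => [|n IH].
  move=> i; rewrite !expr0 fps1 mul1r; case: eqP => [->|_] /=; first by rewrite nabs1.
  by rewrite nabs0 // exprn_ge0.
by rewrite !exprS; apply: fboundM => //; apply: exprn_ge0.
Qed.

(** A single [r] is both constant and ratio, so the bounds of two series are merged by a maximum. *)
Definition geometric a :=
  coef_in a /\ exists2 r, 1 <= r & forall n, abs (a n) <= r ^+ n.+1.

Lemma geometricI a M r : 0 <= r -> coef_in a -> fbound M r a -> geometric a.
Proof.
move=> r0 Sa ha; split=> //; pose r' := Num.max 1 (Num.max M r).
have r1 : 1 <= r' by rewrite le_max lexx.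
have r'0 : 0 <= r' by apply: le_trans r1.
have Mr : M <= r' by rewrite !le_max lexx orbT.
have rr : r <= r' by rewrite !le_max lexx !orbT.
exists r' => // n; apply: le_trans (ha n) _; rewrite exprS.
apply: le_trans (ler_wpM2r (exprn_ge0 _ r0) Mr) _.
by apply: ler_wpM2l => //; apply: lerXn2r.
Qed.

Lemma geometric_fbound a : geometric a -> exists2 r, 1 <= r & fbound r r a.
Proof. by move=> [_ [r r1 ha]]; exists r => // n; rewrite -exprS. Qed.

(** Without constant term the factor is absorbed by the ratio, as [r ^ n.+1 <= (r ^ 2) ^ n] for
    [n > 0]. A factor [1] makes the bounds on the powers of [a] uniform in the exponent. *)
Lemma geometric_fbound1 a : geometric a -> a 0%N = 0 ->
  exists2 r, 1 <= r & fbound 1 r a.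
Proof.
move=> [_ [r r1 ha]] a0; exists (r ^+ 2); first exact: exprn_ege1.
move=> [|n]; first by rewrite a0 nabs0 // mul1r expr0.
by rewrite mul1r -exprM; apply: le_trans (ha _) _; apply: ler_weXn2l => //; lia.
Qed.

Lemma fbound_le M M' r r' a : 0 <= M -> 0 <= r -> M <= M' -> r <= r' ->
  fbound M r a -> fbound M' r' a.
Proof.
move=> M0 r0 MM rr ha n; apply: le_trans (ha n) _; apply: ler_pM => //.
  exact: exprn_ge0.
by apply: lerXn2r => //; rewrite nnegrE // (le_trans r0).
Qed.

Lemma geometric2 a b : geometric a -> geometric b ->
  exists2 r, 1 <= r & fbound r r a /\ fbound r r b.
Proof.
move=> /geometric_fbound[r r1 ha] /geometric_fbound[r' r'1 hb].
have r0 : 0 <= r by apply: le_trans r1.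
have r'0 : 0 <= r' by apply: le_trans r'1.
exists (Num.max r r'); first by rewrite le_max r1.
split; first by apply: (@fbound_le r _ r); rewrite // le_max lexx.
by apply: (@fbound_le r' _ r'); rewrite // le_max lexx orbT.
Qed.

Lemma geometricM a b : geometric a -> geometric b -> geometric (a * b).
Proof.
move=> ga gb; have [r r1 [ha hb]] := geometric2 ga gb.
have r0 : 0 <= r by apply: le_trans r1.
apply: (geometricI r0 _ (fboundM r0 r0 r0 ha hb)).
by apply: coef_inM; [case: ga | case: gb].
Qed.

Lemma geometricB a b : geometric a -> geometric b -> geometric (a - b).
Proof.
move=> ga gb; have [r r1 [ha hb]] := geometric2 ga gb.
have r0 : 0 <= r by apply: le_trans r1.
apply: (@geometricI _ r r r0) => [n|n].
  by apply: subr_sub => //; [case: ga | case: gb].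
exact: nabsB_le.
Qed.

Lemma geometricC c : S c -> geometric (fC c).
Proof.
move=> Sc; apply: (@geometricI _ (abs c) 1) => // [|n]; first exact: coef_inC.
rewrite expr1n mulr1 /fC nabsM //; apply: ler_piMr => //.
exact: nabs_nat.
Qed.

Lemma geometric1 : geometric 1.
Proof. by rewrite -(rmorph1 (@fC L)); apply: geometricC; apply: subr_one. Qed.

Lemma geometric_fX : geometric fX.
Proof.
apply: (@geometricI _ 1 1) => // n; first exact: subr_nat.
by rewrite expr1n mulr1; apply: nabs_nat.
Qed.

Lemma geometricX a n : geometric a -> geometric (a ^+ n).
Proof.
move=> ga; elim: n => [|n IH]; first exact: geometric1.
by rewrite exprS; apply: geometricM.
Qed.

Lemma geometric_shift k a : geometric a -> geometric (fshift k a).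
Proof.
move=> ga; have [r r1 ha] := geometric_fbound ga.
have r0 : 0 <= r by apply: le_trans r1.
apply: (@geometricI _ (r * r ^+ k) r) => // n; first by case: ga => Sa _; apply: Sa.
by apply: le_trans (ha _) _; rewrite -mulrA -exprD addnC.
Qed.

Lemma geometric_comp a b : geometric a -> geometric b -> b 0%N = 0 ->
  geometric (fcomp a b).
Proof.
move=> [Sa [r r1 ha]] gb b0; have [s s1 hb] := geometric_fbound1 gb b0.
have r0 : 0 <= r by apply: le_trans r1.
have s0 : 0 <= s by apply: le_trans s1.
apply: (@geometricI _ r (r * s)); first exact: mulr_ge0.
  by apply: coef_in_comp => //; case: gb.
move=> n; rewrite exprMn mulrA -exprS; apply: nabs_sum_le => //.
  by rewrite mulr_ge0 // exprn_ge0.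
move=> i _; rewrite nabsM // ps_expE; apply: ler_pM => //.
  by apply: le_trans (ha _) _; apply: ler_weXn2l => //; have := ltn_ord i; lia.
by have := fboundX i ler01 s0 hb; rewrite expr1n => /(_ n); rewrite mul1r.
Qed.

(** The reciprocal is the geometric series evaluated at [1 - a], which has no constant term. *)
Lemma geometric_inv a : geometric a -> a 0%N = 1 ->
  exists2 b, geometric b & b * a = 1.
Proof.
move=> ga a1; pose g : fps L := fun=> 1.
have gg : g * (1 - fX) = 1.
  apply/funext => n; rewrite mulrBr mulr1 mulrC -[fX]expr1 fpsB fXnM fps1.
  by case: n => [|n]; rewrite /g /= ?subr0 ?subrr.
have a0 : (1 - a) 0%N = 0 by rewrite fpsB fps1 a1 subrr.
exists (fcomp g (1 - a)).
  apply: geometric_comp => //; last by apply: geometricB => //; exact: geometric1.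
  apply: (@geometricI _ 1 1) => // n; first exact: subr_one.
  by rewrite expr1n nabs1 // mulr1.
have := congr1 (fun c : fps L => fcomp c (1 - a)) gg.
by rewrite fcompM // fcompB fcomp1 fcompX // subKr.
Qed.

(* With [|a_n| <= r ^ n.+1], [w -> B - (a - x) o w - C w] preserves
   [|w_n| <= r^-3 s ^ n] as soon as [s] is large compared with [r], [B], [C]. *)
Lemma geometric_implicit a B C : geometric a -> geometric B -> geometric C ->
  a 0%N = 0 -> a 1%N = 1 -> B 0%N = 0 -> C 0%N = 0 ->
  exists2 w, geometric w /\ w 0%N = 0 & fcomp a w + C * w = B.
Proof.
move=> [Sa [r r1 ha]] gB gC a0 a1 B0 C0.
have [tB tB1 hB] := geometric_fbound1 gB B0.
have [tC tC1 hC] := geometric_fbound1 gC C0.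
pose t := Num.max tB tC.
have t1 : 1 <= t by rewrite le_max tB1.
have {}hB : fbound 1 t B.
  by apply: (fbound_le ler01 _ _ _ hB); rewrite ?(le_trans ler01) // le_max lexx.
have {}hC : fbound 1 t C.
  by apply: (fbound_le ler01 _ _ _ hC); rewrite ?(le_trans ler01) // le_max lexx orbT.
have r0 : 0 < r by apply: lt_le_trans r1.
have t0 : 0 <= t by apply: le_trans t1.
(* For [i >= 2], [r ^ i.+1 eps ^ i <= eps] follows from [i + 1 <= 3 (i - 1)], an equality at
   [i = 2]: hence the exponent [3]. The factor [r ^ 3] in [s] gives [t ^ n <= eps s ^ n] for
   [n >= 1], which takes care of [B]. *)
pose eps := (r ^+ 3)^-1; pose s := r ^+ 3 * t.
have e0 : 0 <= eps by rewrite invr_ge0 exprn_ge0 // ltW.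
have s0 : 0 <= s by rewrite mulr_ge0 // exprn_ge0 // ltW.
have ts : t <= s by apply: ler_peMl => //; apply: exprn_ege1.
pose a2 := a - fX.
have a20 : a2 0%N = 0 by rewrite /a2 fpsB a0 subr0.
have a21 : a2 1%N = 0 by rewrite /a2 fpsB a1 subrr.
(* The clause at [n = 0] keeps [w 0 = 0] along the iteration, on which composition and contraction
   rely. *)
pose P n x := [/\ S x, abs x <= eps * s ^+ n & n = 0%N -> x = 0].
pose Phi w := B - fcomp a2 w - C * w.
have PP w : (forall n, P n (w n)) -> [/\ coef_in w, fbound eps s w & w 0%N = 0].
  move=> Pw; split=> [n|n|]; [by case: (Pw n) | by case: (Pw n) |].
  by case: (Pw 0%N) => _ _; apply.
have Sa2 : coef_in a2 by move=> n; apply: subr_sub => //; apply: subr_nat.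
have [|w Pw n|k w w' Pw Pw' ww'|w Pw ew] := @fps_fixpoint _ P Phi 0.
- move=> n; split => //; first exact: subr_0.
  by rewrite nabs0 // mulr_ge0 // exprn_ge0.
- have [Sw hw w0] := PP _ Pw.
  rewrite /Phi !fpsB; split.
  + apply: (subr_sub Sring); last by apply: coef_inM => //; case: gC.
    by apply: (subr_sub Sring); [case: gB => SB _; apply: SB | apply: coef_in_comp].
  + have tail i : abs (a2 i * (w ^+ i) n) <= eps * s ^+ n.
      case: i => [|[|i]]; try by rewrite ?a20 ?a21 mul0r nabs0 // mulr_ge0 // exprn_ge0.
      rewrite nabsM // /a2 fpsB -[fX]expr1 fXn subr0.
      apply: (@le_trans _ _ (r ^+ i.+3 * (eps ^+ i.+2 * s ^+ n))).
        by apply: ler_pM => //; apply: fboundX.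
      rewrite mulrA; apply: ler_wpM2r; first exact: exprn_ge0.
      rewrite [eps ^+ _]exprS mulrCA; apply: ler_piMr => //.
      rewrite exprVn -exprM ler_pdivrMr ?exprn_gt0 // mul1r.
      by apply: ler_weXn2l => //; lia.
    apply: nabsB_le => //; first apply: nabsB_le => //.
    * case: n tail => [|n] tail; first by rewrite B0 nabs0 // mulr_ge0 // exprn_ge0.
      apply: le_trans (hB _) _; rewrite mul1r /s exprMn mulrA.
      apply: ler_peMl; first exact: exprn_ge0.
      rewrite exprS mulrA mulVf ?mul1r ?exprn_ege1 // ?exprn_ege1 //.
      by rewrite expf_neq0 // gt_eqF.
    * apply: nabs_sum_le => [//||i _]; first by rewrite mulr_ge0 // exprn_ge0.
      by rewrite ps_expE.
    * apply: nabs_sum_le => [//||i _]; first by rewrite mulr_ge0 // exprn_ge0.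
      rewrite nabsM //; apply: le_trans (ler_pM _ _ (hC i) (hw _)) _ => //.
      rewrite mul1r mulrCA; apply: ler_wpM2l => //.
      apply: (@le_trans _ _ (s ^+ i * s ^+ (n - i))).
        by apply: ler_wpM2r; [exact: exprn_ge0 | exact: lerXn2r].
      by rewrite -exprD subnKC // -ltnS.
  + by move=> ->; rewrite B0 fcomp_0 a20 coefM0 C0 mul0r !subr0.
(* One degree is gained in each term: [a2] has no linear part and [C] no constant term. *)
- have [_ _ w0] := PP _ Pw; have [_ _ w'0] := PP _ Pw'.
  move=> i ik; rewrite /Phi !fpsB (eqmS_fcomp a20 a21 w0 w'0 ww' ik); congr (_ - _).
  apply/eqP; rewrite -subr_eq0 -fpsB -mulrBr; apply/eqP.
  by apply: (eqm0M (k := 1) (l := k) _ _ ik); [case | apply: eqm_subr0].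
have [Sw hw w0] := PP _ Pw.
exists w; first by split => //; apply: geometricI s0 Sw hw.
have : fcomp a w = fcomp a2 w + w by rewrite fcompB fcompX // subrK.
by move=> ->; rewrite -{2}ew /Phi; ring.
Qed.

End GeometricSeries.

(** * Geometric bounds for exponentials, primitives and invariant fields *)

Section GeometricSolutions.
Variables (R : realType) (L : fieldType) (abs : L -> R) (S : set L).
Hypothesis absL : nonarch_abs abs.
Hypothesis char0 : forall n, n.+1%:R != 0 :> L.
Hypothesis Sring : rational_subring S.
Implicit Types (a b F : fps L).

Let abs_ge0 x : 0 <= abs x. Proof. exact: nabs_ge0 absL x. Qed.
Local Hint Resolve abs_ge0 : core.
Local Notation geometric := (geometric abs S).

Lemma geometric_fexp : geometric (fexp L).
Proof.
have [beta b1 hb] := nabs_fact_ge absL char0.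
have b0 : 0 <= beta by apply: le_trans b1.
apply: (@geometricI _ _ _ _ _ 1 beta) => // n; first exact: subr_natV.
by rewrite mul1r nabsV.
Qed.

Lemma geometric_fexpm d : geometric (fexpm L d).
Proof.
have [beta b1 hb] := nabs_fact_ge absL char0.
have b0 : 0 <= beta by apply: le_trans b1.
apply: (@geometricI _ _ _ _ _ 1 beta) => // -[|n] /=; rewrite ?mul1r.
- exact: subr_0.
- apply: subr_mul => //; last exact: subr_natV.
  by apply: subr_exp => //; apply: subr_opp => //; apply: subr_nat.
- by rewrite nabs0 // expr0.
rewrite nabsM // nabsV // nabsX // nabsN //.
apply: le_trans (hb _); apply: ler_piMl; first by rewrite invr_ge0.
by apply: exprn_ile1 => //; apply: nabs_nat.
Qed.

Lemma nabs_natV : exists2 beta : R, 1 <= beta &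
  forall n, (0 < n)%N -> (abs n%:R)^-1 <= beta ^+ n.
Proof.
have [beta b1 hb] := nabs_fact_ge absL char0.
exists beta => // n n0; apply: le_trans (hb n).
have f0 k : 0 < abs k`!%:R by rewrite nabs_gt0 // fact_neq0.
rewrite lef_pV2 ?posrE //; last by rewrite nabs_gt0 // -(prednK n0).
rewrite -(prednK n0) factS natrM nabsM //; apply: ler_piMr => //.
exact: nabs_nat.
Qed.

Lemma geometric_fprim d W : geometric W -> geometric (fprim d W).
Proof.
move=> gW; have [r r1 hW] := geometric_fbound gW.
have r0 : 0 <= r by apply: le_trans r1.
have [beta b1 hb] := nabs_natV.
have b0 : 0 <= beta by apply: le_trans b1.
have natd n : n != d -> S (n%:R - d%:R)^-1 /\
    abs (n%:R - d%:R)^-1 <= beta ^+ d * beta ^+ n.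
  move=> nd; have [lt|le] := ltnP d n.
    rewrite -natrB 1?ltnW //; split; first exact: subr_natV.
    rewrite nabsV //; apply: le_trans (hb _ _) _; first by rewrite subn_gt0.
    by rewrite -exprD; apply: ler_weXn2l => //; lia.
  have lt : (n < d)%N by lia.
  rewrite -opprB invrN -natrB //; split.
    by apply: subr_opp => //; exact: subr_natV.
  rewrite nabsN // nabsV //; apply: le_trans (hb _ _) _; first by rewrite subn_gt0.
  by rewrite -exprD; apply: ler_weXn2l => //; lia.
apply: (@geometricI _ _ _ _ _ (r * beta ^+ d) (r * beta)) => [|n|n].
- exact: mulr_ge0.
- rewrite /fprim; case: eqVneq => //= _; first exact: subr_0.
  case: eqVneq => nd; first exact: subr_0.
  by apply: subr_mul; [| case: gW => SW _; apply: SW | case: (natd n nd)].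
rewrite /fprim; case: ifP => [_|/norP[_ nd]].
  by rewrite nabs0 // !mulr_ge0 ?exprn_ge0 // mulr_ge0.
rewrite nabsM // exprMn mulrACA; apply: ler_pM => //.
by case: (natd n nd).
Qed.

(* The coefficient of degree [n + d] of Julia's equation is
   [(n - d - 1) v_n = \sum_(i < n) (..) v_i], so dividing by [n - d - 1] at each
   step costs [1 / |(n - d - 1)!|] in total. *)
Lemma julia_solution d F : (0 < d)%N -> geometric F ->
  F 0%N = 0 -> eqm d.+1 F fX -> F d.+1 = 1 ->
  exists2 v, geometric v & eqm d.+2 v (fX ^+ d.+1) /\ julia F v = 0.
Proof.
move=> d0 gF F0 FX Fd.
have [beta b1 hbeta] := nabs_fact_ge absL char0.
have b0 : 0 <= beta by apply: le_trans b1.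
have SF : coef_in S F by case: gF.
(* The constant term of [F / x] is [1], so a bound with factor [1] is possible, and all powers of
   [F / x] share it. *)
have [r r1 hb] : exists2 r, 1 <= r & fbound abs 1 r (fshift 1 F).
  have [r0 r01 hF] := geometric_fbound1 absL gF F0.
  exists (r0 ^+ 2); first exact: exprn_ege1.
  move=> [|n]; first by rewrite /fshift FX // nabs1 // mul1r expr0.
  apply: le_trans (hF _) _; rewrite !mul1r -exprM; apply: ler_weXn2l => //; lia.
have r0 : 0 < r by apply: lt_le_trans r1.
(* For [i < n] one has [(n + d - i) + (d + 1) i <= (d + 1) n]: the bound [r ^ (n + d - i)] on
   [c n i] is absorbed in passing from [s ^ i] to [s ^ n]. *)
pose s := r ^+ d.+1.
have s1 : 1 <= s by apply: exprn_ege1.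
have s0 : 0 <= s by apply: le_trans s1.
have Fb : F = fX * fshift 1 F by rewrite -[fX]expr1; apply: fshiftK; case.
have juliaX i : julia F (fX ^+ i) = fX ^+ i * (fder F - fshift 1 F ^+ i).
  by rewrite /julia fcomp_exp // fcompX // {2}Fb exprMn; ring.
pose c n i := julia F (fX ^+ i) (n + d)%N.
have Sc n i : S (c n i).
  rewrite /c juliaX; apply: coef_inM => //; first by apply: coef_inX => // k; apply: subr_nat.
  move=> k; rewrite fpsB; apply: subr_sub => //; first exact: coef_in_der.
  by apply: coef_inX => // j; apply: SF.
have hc n i : (i < n)%N -> abs (c n i) <= r ^+ (n + d - i).
  move=> lt; rewrite /c juliaX fXnM; case: ltnP => [|_]; first by lia.
  have fd : fbound abs 1 r (fder F).
    move=> k; rewrite /fder nabsM //; apply: le_trans (ler_piMl _ _) _ => //.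
      exact: nabs_nat.
    by have := hb k; rewrite /fshift addn1.
  have := fboundX absL i ler01 (ltW r0) hb; rewrite expr1n => fb.
  by have := nabsB_le absL (fd (n + d - i)%N) (fb (n + d - i)%N); rewrite mul1r.
(* Up to degree [d + 1] the truncated difference is [0] and the factorial is [1]. In degree [d + 1]
   itself the divisor vanishes: the coefficient is free, and [Phi] sets it to [1]. *)
pose P n x := S x /\ abs x <= s ^+ n * (abs (n - d.+1)`!%:R)^-1.
pose Phi (v : fps L) : fps L := fun n =>
  if (n < d.+1)%N then 0 else if n == d.+1 then 1 else
  (n - d.+1)%:R^-1 * \sum_(i < n) c n i * v i.
have B0 n k : 0 <= s ^+ n * (abs k`!%:R)^-1.
  by apply: mulr_ge0; [exact: exprn_ge0 | rewrite invr_ge0].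
have [|v Pv n|k v v' _ _ vv' n nk|v Pv ev] := @fps_fixpoint _ P Phi 0.
- move=> n; split; first exact: subr_0.
  by rewrite nabs0.
- rewrite /P /Phi; case: ltnP => [_|dn].
    split; first exact: subr_0.
    by rewrite nabs0.
  case: eqVneq => [->|nd].
    split; first exact: subr_one.
    by rewrite subnn fact0 nabs1 // invr1 mulr1 exprn_ege1.
  have {dn nd} [k ->] : exists k, n = (d.+1 + k).+1 by exists (n - d.+2)%N; lia.
  split.
    apply: subr_mul => //; first exact: subr_natV.
    by apply: subr_sum => // i _; apply: subr_mul => //; case: (Pv i).
  have -> : ((d.+1 + k).+1 - d.+1 = k.+1)%N by lia.
  have -> : abs k.+1`!%:R = abs k.+1%:R * abs k`!%:R by rewrite factS natrM nabsM.
  rewrite (nabsM absL k.+1%:R^-1) (nabsV absL) invfM mulrCA; apply: ler_wpM2l.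
    by rewrite invr_ge0.
  apply: nabs_sum_le => [//||i _]; first exact: B0.
  case: (Pv i) => _ hv; rewrite nabsM //.
  apply: le_trans (ler_pM _ _ (hc _ _ (ltn_ord i)) hv) _ => //.
  rewrite mulrA; apply: ler_pM.
  + by apply: mulr_ge0; apply: exprn_ge0 => //; apply: ltW.
  + by rewrite invr_ge0.
  + rewrite -!exprM -exprD; apply: ler_weXn2l => //; have := ltn_ord i; nia.
  rewrite lef_pV2 ?posrE ?nabs_gt0 ?fact_neq0 //.
  by apply: nabs_fact_le => //; have := ltn_ord i; lia.
- rewrite /Phi; case: ifP => // _; case: ifP => // _; congr (_ * _).
  by apply: eq_bigr => i _; rewrite vv' //; have := ltn_ord i; lia.
have vlow i : (i < d.+1)%N -> v i = 0 by move=> id; rewrite -ev /Phi id.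
have vd : v d.+1 = 1 by rewrite -ev /Phi ltnn eqxx.
exists v.
  apply: (@geometricI _ _ _ _ _ 1 (s * beta)) => [|n|n]; first exact: mulr_ge0.
    by case: (Pv n).
  case: (Pv n) => _ h; apply: le_trans h _.
  rewrite mul1r exprMn; apply: ler_wpM2l; first exact: exprn_ge0.
  by apply: le_trans (hbeta _) _; apply: ler_weXn2l => //; apply: leq_subr.
split.
  move=> i; rewrite ltnS leq_eqVlt fXn => /orP[/eqP ->|id]; first by rewrite vd eqxx.
  by rewrite vlow // ltn_eqF.
have juliaE N : julia F v N = \sum_(i < N.+1) julia F (fX ^+ i) N * v i.
  have vE : eqm N.+1 v (\sum_(i < N.+1) fC (v i) * fX ^+ i).
    by rewrite -{1}[v]fcomp_fX; apply: eqm_fcomp_sum.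
  have -> : julia F v N = julia F (\sum_(i < N.+1) fC (v i) * fX ^+ i) N.
    rewrite /julia !fpsB (eqmM (eqm_refl N.+1 (fder F)) vE) //.
    by rewrite (eqm_fcompl F vE).
  have julia_sum I (l : seq I) (G : I -> fps L) :
      julia F (\sum_(i <- l) G i) = \sum_(i <- l) julia F (G i).
    elim: l => [|x l IH]; last by rewrite !big_cons -IH /julia fcompD; ring.
    by rewrite !big_nil -{1}(subrr 0) juliaB subrr.
  rewrite julia_sum fps_sum; apply: eq_bigr => i _.
  rewrite [RHS]mulrC -fCM; congr ((_ : fps L) N).
  by rewrite /julia fcompM // fcompC; ring.
have cX i := coef_julia d0 F0 FX (eqm_fXn i).
apply/funext => N; rewrite juliaE fps0.
(* Below degree [2 d + 1] every term has a zero factor. In degree [n + d] the terms with [i > n]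
   vanish, and the others cancel by the recursion, or are all zero if [n = d + 1]. *)
have [lt|le] := ltnP N (d.+1 + d).
  rewrite big1 // => i _; have [id|di] := ltnP i d.+1; first by rewrite vlow // mulr0.
  by have [h _] := cX i; rewrite h ?mul0r //; lia.
have [n -> dn] : exists2 n, N = (n + d)%N & (d.+1 <= n)%N by exists (N - d)%N; lia.
rewrite -(big_mkord xpredT (fun i => julia F (fX ^+ i) (n + d)%N * v i)).
rewrite (@big_cat_nat _ _ _ n.+1) //=; last by lia.
rewrite [X in _ + X]big_nat [X in _ + X]big1 ?addr0; last first.
  by move=> i /andP[ni _]; have [h _] := cX i; rewrite h ?mul0r //; lia.
rewrite big_mkord big_ord_recr /=; have [_ ->] := cX n.
rewrite Fd fXn eqxx !mulr1; move: dn; rewrite leq_eqVlt => /orP[/eqP <-|dn].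
  rewrite subrr mul0r addr0 big1 // => i _.
  by rewrite vlow ?mulr0 //; have := ltn_ord i; lia.
have nd : (n - d.+1)%:R != 0 :> L by rewrite -(prednK (n := n - d.+1)%N) ?subn_gt0.
have := congr1 (fun a : fps L => a n) ev; rewrite /Phi.
have -> : (n < d.+1)%N = false by lia.
have -> : (n == d.+1) = false by lia.
move=> evn; rewrite -evn -opprB -natrB 1?ltnW // mulNr mulrA divff // mul1r.
by rewrite subrr.
Qed.

End GeometricSolutions.

(** * Conjugation to the normal form with geometric bounds *)

Section GeometricConjugacy.
Variables (R : realType) (L : fieldType) (abs : L -> R) (S : set L).
Hypothesis absL : nonarch_abs abs.
Hypothesis char0 : forall n, n.+1%:R != 0 :> L.
Hypothesis Sring : rational_subring S.
Implicit Types (a b F h k v W : fps L).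
Local Notation geometric := (geometric abs S).

(** Right inverses solve the implicit equation with [C = 0]. As in a group, a right inverse of a
    right inverse is the original series, so the inverse is two-sided. *)
Lemma geometric_compositional_inverse h : geometric h -> h 0%N = 0 -> h 1%N = 1 ->
  exists2 k, geometric k &
    [/\ k 0%N = 0, k 1%N = 1, fcomp h k = fX & fcomp k h = fX].
Proof.
have right_inverse a : geometric a -> a 0%N = 0 -> a 1%N = 1 ->
    exists2 k, geometric k & [/\ k 0%N = 0, k 1%N = 1 & fcomp a k = fX].
  move=> ga a0 a1.
  have [k [gk k0] ek] := geometric_implicit absL Sring ga (geometric_fX absL Sring)
    (geometricC absL Sring (subr_0 Sring)) a0 a1 erefl (mul0r _).
  rewrite rmorph0 mul0r addr0 in ek; exists k => //; split=> //.
  by have := congr1 (fun c : fps L => c 1%N) ek; rewrite fcomp_1 // a1 mul1r.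
move=> gh h0 h1; have [k gk [k0 k1 hk]] := right_inverse h gh h0 h1.
have [h' gh' [h'0 h'1 kh']] := right_inverse k gk k0 k1.
exists k => //; split=> //.
suff -> : h = h' by [].
by rewrite -(fcompX h'0) -hk fcompA // kh' fcomp_fX.
Qed.

Lemma linearize d v : (0 < d)%N -> geometric v -> eqm d.+2 v (fX ^+ d.+1) ->
  exists W h, [/\ W * fshift d.+1 v = 1, S (W d),
    geometric h /\ h 0%N = 0, h 1%N = 1 &
    fder h * v * (1 + fC (W d) * h ^+ d) = h ^+ d.+1].
Proof.
move=> d0 gv vX; set V := fshift d.+1 v.
have V0 : V 0%N = 1 by rewrite /V /fshift add0n vX // fXn eqxx.
have vV : v = fX ^+ d.+1 * V.
  by apply: fshiftK => i id; rewrite vX ?fXn ?ltn_eqF // ltnW.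
have gX := geometric_fX absL Sring.
have [W gW WV] := geometric_inv absL Sring (geometric_shift d.+1 gv) V0.
have W0 : W 0%N = 1.
  by have := congr1 (fun c : fps L => c 0%N) WV; rewrite coefM0 -/V V0 mulr1.
have SWd : S (W d) by case: gW => SW _; apply: SW.
have gC : geometric (fC (W d) * fX ^+ d).
  by apply: geometricM => //; [apply: geometricC | apply: geometricX].
have C0 : (fC (W d) * fX ^+ d) 0%N = 0 by rewrite fCM fXn ltn_eqF // mulr0.
(* The linear coefficient of [fexpm] is [(- d) ^ 0 / 1! = 1], so solving for [w] introduces no
   divisor. *)
have [w [gw w0] ew] := geometric_implicit absL Sring
  (geometric_fexpm absL char0 Sring d) (geometric_fprim absL char0 Sring d gW) gC
  erefl (divff (oner_neq0 L)) erefl C0.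
exists W, (fX * fcomp (fexp L) w); split=> //.
- split; last by rewrite coefM0 mul0r.
  apply: geometricM => //; apply: geometric_comp => //.
  exact: geometric_fexp.
- have := coef_fXnM 1 (fcomp (fexp L) w) 0; rewrite expr1 => ->.
  by rewrite fcomp_0 /fexp fact0 invr1.
by rewrite vV; apply: linearize_formal.
Qed.

Lemma geometric_normal_form d F : (0 < d)%N -> geometric F ->
  F 0%N = 0 -> eqm d.+1 F fX -> F d.+1 = 1 ->
  exists mu h, [/\ S mu, geometric h, h 0%N = 0, h 1%N = 1 &
    fcomp h F = fcomp (fnormal d.+1 mu) h].
Proof.
move=> d0 gF F0 FX Fd.
have [vF gvF [vFX jF]] := julia_solution absL char0 Sring d0 gF F0 FX Fd.
have [W [hF [WV SW [ghF hF0] hF1 eF]]] := linearize d0 gvF vFX.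
pose mu := 'C(d.+1, 2)%:R / d%:R - W d.
have Smu : S mu.
  apply: (subr_sub Sring) => //; apply: (subr_mul Sring); first exact: subr_nat.
  exact: subr_natV.
pose N := fnormal d.+1 mu.
have gN : geometric N.
  have gX := geometric_fX absL Sring.
  rewrite /N /fnormal -[_ * fX ^+ _]opprK; apply: geometricB => //.
    rewrite -[fX ^+ d.+1]opprK; apply: geometricB => //.
    by rewrite -sub0r -(rmorph0 (@fC L)); apply: geometricB => //;
      [apply: geometricC => //; apply: subr_0 | apply: geometricX].
  rewrite -mulNr -rmorphN /=; apply: geometricM => //; last exact: geometricX.
  by apply: geometricC => //; apply: subr_opp.
have N0 : N 0%N = 0 by rewrite /N fnormal_eqm.
have NX : eqm d.+1 N fX by apply: fnormal_eqm.
have Nd : N d.+1 = 1 by apply: fnormal_m.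
have [vN gvN [vNX jN]] := julia_solution absL char0 Sring d0 gN N0 NX Nd.
have [W' [hN [WV' SW' [ghN hN0] hN1 eN]]] := linearize d0 gvN vNX.
(* As [V = 1 + c x ^ d] modulo [x ^ d.+1], its reciprocal [W'] has coefficient [- c] in degree
   [d]. *)
have WW' : W' d = W d.
  have := julia_fnormal char0 d0 vNX jN.
  set c := mu - _ => vNE; set V := fshift _ _ in WV'.
  have VE : eqm d.+1 V (1 + fC c * fX ^+ d).
    move=> i id; rewrite /V /fshift vNE; last by lia.
    by rewrite addnC coef_fXnM.
  have V1 : eqm d (V - 1) 0.
    apply: eqm_subr0 => i id; rewrite VE; last exact: ltnW.
    rewrite fpsD fCM fXn ltn_eqF //.
    by rewrite mulr0 addr0.
  have Vd : (V - 1) d = c.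
    by rewrite fpsB VE // fpsD fCM fXn eqxx mulr1 addrAC subrr add0r.
  have V0 : V 0%N = 1 by rewrite VE // fpsD fCM fXn ltn_eqF // mulr0 addr0.
  have W'0 : W' 0%N = 1.
    by have := congr1 (fun c : fps L => c 0%N) WV'; rewrite coefM0 V0 mulr1.
  have e : W' + (V - 1) * W' = 1.
    by rewrite mulrBl mul1r [V * W']mulrC WV' addrCA subrr addr0.
  have := congr1 (fun c : fps L => c d) e.
  rewrite fpsD coef0Ml // Vd W'0 mulr1 fps1 gtn_eqF // => /eqP.
  by rewrite addr_eq0 => /eqP ->; rewrite /c /mu addrAC subrr add0r opprK.
rewrite WW' in eN.
have [k gk [k0 k1 hk kh]] := geometric_compositional_inverse ghN hN0 hN1.
(* Through the common model: [hF] leads to it, and the inverse [k] of [hN] leads back. *)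
pose h := fcomp k hF.
have h0 : h 0%N = 0 by rewrite /h fcomp_0.
have h1 : h 1%N = 1 by rewrite /h fcomp_1 // k1 hF1 mulr1.
have hNh : fcomp hN h = hF by rewrite -fcompA // hk fcompX.
exists mu, h; split=> //; first exact: geometric_comp.
have e := conjugate_vector_fields d0 h0 hF0 hN1 hNh eF eN.
exact: (conjugate_maps char0 d0 F0 FX Fd h0 h1 vFX vNX jF jN e).
Qed.

End GeometricConjugacy.

(** * Coefficient bounds versus convergence *)

Section AbsConvergence.
Variables (R : realType) (L : fieldType) (abs : L -> R).
Hypothesis absL : nonarch_abs abs.
Implicit Types (u : nat -> L) (S : set L).

Let abs_ge0 x : 0 <= abs x. Proof. exact: nabs_ge0 absL x. Qed.
Local Hint Resolve abs_ge0 : core.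

Lemma abs_cvgP u l : abs_cvg abs u l <->
  forall e : R, 0 < e -> exists N, forall n, (N <= n)%N -> abs (u n - l) < e.
Proof.
split=> [/cvgrPdist_lt ul e e0|ul].
  have [N _ hN] := ul e e0; exists N => n /hN /=.
  by rewrite sub0r normrN ger0_norm.
apply/cvgrPdist_lt => e e0; have [N hN] := ul e e0.
by exists N => // n /= /hN; rewrite sub0r normrN ger0_norm.
Qed.

Lemma nabsD_lt x y e : abs x < e -> abs y < e -> abs (x + y) < e.
Proof.
by move=> xe ye; case: absL => _ _ _ /(_ x y)/le_lt_trans; apply; rewrite gt_max xe.
Qed.

Lemma nabsB_lt x y e : abs x < e -> abs y < e -> abs (x - y) < e.
Proof. by move=> xe ye; apply: nabsD_lt; rewrite ?(nabsN absL). Qed.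

Lemma abs_cvg_cauchy u l : abs_cvg abs u l -> abs_cauchy abs u.
Proof.
move=> /abs_cvgP ul e e0; have [N hN] := ul e e0.
exists N => i j Ni Nj; have -> : u i - u j = (u i - l) - (u j - l) by ring.
by apply: nabsB_lt; apply: hN.
Qed.

Lemma abs_cvgB u u' l l' : abs_cvg abs u l -> abs_cvg abs u' l' ->
  abs_cvg abs (fun n => u n - u' n) (l - l').
Proof.
move=> /abs_cvgP ul /abs_cvgP ul'; apply/abs_cvgP => e e0.
have [N hN] := ul e e0; have [N' hN'] := ul' e e0.
exists (maxn N N') => n; rewrite geq_max => /andP[Nn N'n].
have -> : u n - u' n - (l - l') = (u n - l) - (u' n - l') by ring.
by apply: nabsB_lt; [apply: hN | apply: hN'].
Qed.

Lemma abs_cvgMr u l x : abs_cvg abs u l -> abs_cvg abs (fun n => u n * x) (l * x).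
Proof.
move=> /abs_cvgP ul; apply/abs_cvgP => e e0.
have [->|x0] := eqVneq x 0.
  by exists 0%N => n _; rewrite !mulr0 subrr (nabs0 absL).
have ax : 0 < abs x by rewrite (nabs_gt0 absL).
have [N hN] := ul (e / abs x) (divr_gt0 e0 ax).
by exists N => n Nn; rewrite -mulrBl (nabsM absL) -ltr_pdivlMr //; apply: hN.
Qed.

Lemma abs_cvg_unique u l l' : abs_cvg abs u l -> abs_cvg abs u l' -> l = l'.
Proof.
move=> ul ul'; apply/eqP; rewrite -subr_eq0; apply/negP => /negP ll'.
have : 0 < abs (l - l') by rewrite (nabs_gt0 absL).
have /abs_cvgP := abs_cvgB ul ul' => h /h[N /(_ N (leqnn _))].
by rewrite subrr sub0r (nabsN absL) ltxx.
Qed.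

Definition complete_in S := forall u, (forall n, S (u n)) -> abs_cauchy abs u ->
  exists2 l, S l & abs_cvg abs u l.

Lemma exp_small (x e : R) : 0 <= x < 1 -> 0 < e ->
  exists N, forall n, (N <= n)%N -> x ^+ n < e.
Proof.
move=> /andP[x0 x1] e0; have x1' : `|x| < 1 by rewrite ger0_norm.
have /cvgrPdist_lt/(_ e e0)[N _ hN] := cvg_expr x1'.
by exists N => n /hN; rewrite /= sub0r normrN ger0_norm ?exprn_ge0.
Qed.

(** A power [y] of [x] is a nonzero point of the disc of convergence. There the terms [a_n y ^ n]
    are eventually at most [1] in absolute value, and the sum in [M] covers the first ones. *)
Lemma analytic_fbound S (a : fps L) x :
  x != 0 -> abs x < 1 -> (forall n, S (x ^+ n)) ->
  analytic abs S a -> exists M r, 0 <= r /\ fbound abs M r a.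
Proof.
move=> x0 x1 Sx [_ [r r0 ha]].
have [N0 hN0] : exists N, forall n, (N <= n)%N -> abs x ^+ n < r.
  by apply: exp_small => //; rewrite abs_ge0.
pose y := x ^+ N0.
have y0 : y != 0 by rewrite expf_neq0.
have ay : 0 < abs y by rewrite (nabs_gt0 absL).
have [|s _ cs] := ha y (Sx N0); first by rewrite (nabsX absL) hN0.
have [N hN] := abs_cvg_cauchy cs ltr01.
pose M := 1 + \sum_(i < N) abs (a i * y ^+ i).
have M1 : 1 <= M by rewrite lerDl sumr_ge0.
exists M, (abs y)^-1; split; first by rewrite invr_ge0.
move=> n; rewrite exprVn ler_pdivlMr ?exprn_gt0 // -(nabsX absL) -(nabsM absL).
have [le|lt] := leqP N n.
  apply: le_trans M1; apply: ltW; have := hN n.+1 n.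
  by rewrite big_ord_recr /= addrAC subrr add0r; apply => //; apply: leqW.
rewrite /M (bigD1 (Ordinal lt)) //= addrCA lerDl addr_ge0 //.
exact: sumr_ge0.
Qed.

Lemma geometric_analytic S a : rational_subring S -> complete_in S ->
  geometric abs S a -> analytic abs S a.
Proof.
move=> Sring Scomplete [Sa [r r1 ha]]; split=> //.
have r0 : 0 < r by apply: lt_le_trans r1.
(* Half the radius suggested by the bound makes the terms at most [r 2^-n]; by the ultrametric
   inequality this also bounds the tails. *)
exists (r^-1 / 2); first by rewrite divr_gt0 ?invr_gt0.
move=> x Sx xr; apply: Scomplete => [n|].
  apply: (subr_sum Sring) => i _; apply: (subr_mul Sring); first exact: Sa.
  exact: subr_exp.
have term n : abs (a n * x ^+ n) <= r * 2^-1 ^+ n.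
  rewrite (nabsM absL) (nabsX absL).
  have xn : abs x ^+ n <= (r^-1 / 2) ^+ n.
    by apply: lerXn2r; rewrite ?nnegrE // ltW // divr_gt0 // invr_gt0.
  apply: le_trans (ler_pM (abs_ge0 _) (exprn_ge0 _ (abs_ge0 _)) (ha n) xn) _.
  by rewrite exprS -mulrA -exprMn [r * (_ / _)]mulrA divff ?gt_eqF // mul1r.
have half : 0 <= (2^-1 : R) < 1 by lra.
move=> e e0; have [N hN] := exp_small half (divr_gt0 e0 r0).
exists N => i j; wlog ij : i j / (j <= i)%N => [H Ni Nj|Ni Nj].
  have [/H|/ltnW/H] := leqP j i; first exact.
  by rewrite -(nabsN absL) opprB; apply.
rewrite -(subnKC ij) big_split_ord /= addrAC subrr add0r.
apply: le_lt_trans (_ : _ <= r * 2^-1 ^+ N) _; last first.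
  by rewrite mulrC -ltr_pdivlMr // hN.
apply: (nabs_sum_le absL) => [|k _].
  by rewrite mulr_ge0 ?exprn_ge0 ?invr_ge0 // ltW.
apply: le_trans (term _) _; apply: ler_wpM2l; first exact: ltW.
by apply: ler_wiXn2l; [lra | lra | lia].
Qed.

End AbsConvergence.

(** * Completeness of finite-dimensional subspaces *)

Section FiniteExtension.
Variables (R : realType) (K : fieldType) (abs : K -> R).
Variables (L : fieldType) (iota : {rmorphism K -> L}) (absL : L -> R).
Hypothesis complete : complete_abs abs.
Hypothesis nonarchL : nonarch_abs absL.
Hypothesis absE : forall x, absL (iota x) = abs x.

(** If [v] is not in [V], completeness of [V] keeps [v] at a distance [d > 0] from it. Then
    [d |c_i - c_j| <= |u_i - u_j|]: the coordinates along [v] are Cauchy in [K], and what remains is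
    Cauchy in [V]. The case [v] in [V] is included because powers of [lambda] may be dependent. *)
Lemma complete_in_add_line (V : set L) v :
  (forall x y, V x -> V y -> V (x - y)) -> (forall c x, V x -> V (iota c * x)) ->
  complete_in absL V ->
  complete_in absL [set z | exists c, V (z - iota c * v)].
Proof.
move=> VB VZ Vc.
have [|nVv] := pselect (V v).
  move=> Vv u Vu cu; have V' z : (exists c, V (z - iota c * v)) -> V z.
    move=> [c Vz]; have -> : z = (z - iota c * v) - (iota (- c) * v).
      by rewrite rmorphN; ring.
    by apply: VB => //; apply: VZ.
  have [n|l Vl ul] := Vc u _ cu; first exact: V' (Vu n).
  by exists l => //; exists 0; rewrite rmorph0 mul0r subr0.
have [d d0 hd] : exists2 d : R, 0 < d & forall x, V x -> d <= absL (v - x).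
  apply: contrapT => H; apply: nVv.
  have /choice[w hw] : forall n, exists x, V x /\ absL (v - x) < 2^-1 ^+ n.
    move=> n; apply: contrapT => Hn; apply: H; exists (2^-1 ^+ n).
      by rewrite exprn_gt0 // invr_gt0.
    by move=> x Vx; rewrite leNgt; apply/negP => lt; apply: Hn; exists x.
  have wv : abs_cvg absL w v.
    apply/(abs_cvgP nonarchL) => e e0.
    have half : 0 <= (2^-1 : R) < 1 by lra.
    have [N hN] := exp_small half e0; exists N => n /hN; apply: lt_trans.
    by rewrite -(nabsN nonarchL) opprB; case: (hw n).
  have [n|l Vl wl] := Vc w _ (abs_cvg_cauchy nonarchL wv); first by case: (hw n).
  by rewrite (abs_cvg_unique nonarchL wv wl).
move=> u /choice[c Vc'] cu.
have dist i j : d * abs (c i - c j) <= absL (u i - u j).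
  have [->|cij] := eqVneq (c i) (c j).
    by rewrite subrr -absE rmorph0 (nabs0 nonarchL) mulr0 (nabs_ge0 nonarchL).
  have c0 : c i - c j != 0 by rewrite subr_eq0.
  have -> : u i - u j = iota (c i - c j) *
      (v - iota (c i - c j)^-1 * ((u j - iota (c j) * v) - (u i - iota (c i) * v))).
    rewrite mulrBr mulrA -rmorphM divff // rmorph1 mul1r rmorphB; ring.
  rewrite (nabsM nonarchL) absE mulrC; apply: ler_wpM2l.
    by rewrite -absE (nabs_ge0 nonarchL).
  by apply: hd; apply: VZ; apply: VB.
have cc : abs_cauchy abs c.
  move=> e e0; have [N hN] := cu (d * e) (mulr_gt0 d0 e0).
  exists N => i j Ni Nj; rewrite -(ltr_pM2l d0).
  exact: le_lt_trans (dist i j) (hN i j Ni Nj).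
have [c' cc'] := complete cc.
have ic' : abs_cvg absL (fun n => iota (c n)) (iota c').
  move: cc'; rewrite /abs_cvg; apply: cvg_trans.
  rewrite (_ : (fun n => absL _) = (fun n => abs (c n - c'))) //.
  by apply/funext => n; rewrite -rmorphB absE.
have cv' := abs_cvgMr nonarchL v ic'.
have cw : abs_cauchy absL (fun n => u n - iota (c n) * v).
  move=> e e0; have [N hN] := cu e e0.
  have [N' hN'] := abs_cvg_cauchy nonarchL cv' e0.
  exists (maxn N N') => i j; rewrite !geq_max => /andP[Ni N'i] /andP[Nj N'j].
  have -> : u i - iota (c i) * v - (u j - iota (c j) * v) =
    (u i - u j) - (iota (c i) * v - iota (c j) * v) by ring.
  by apply: (nabsB_lt nonarchL); [apply: hN | apply: hN'].
have [l Vl wl] := Vc _ Vc' cw.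
exists (l + iota c' * v); first by exists c'; rewrite addrK.
have -> : u = (fun n => (u n - iota (c n) * v) - (iota (- c n) * v)).
  by apply/funext => n; rewrite rmorphN; ring.
have -> : l + iota c' * v = l - (iota (- c') * v) by rewrite rmorphN; ring.
apply: (abs_cvgB nonarchL wl); apply: (abs_cvgMr nonarchL).
have -> : (fun n => iota (- c n)) = (fun n => 0 - iota (c n)).
  by apply/funext => n; rewrite rmorphN sub0r.
rewrite rmorphN -sub0r; apply: (abs_cvgB nonarchL _ ic').
by apply/(abs_cvgP nonarchL) => e e0; exists 0%N => n _; rewrite subrr (nabs0 nonarchL).
Qed.

Variable lambda : L.

(** The span over [K] of the powers of [lambda] below [k]: a filtration growing by one line at a
    time. *)
Definition poly_values k : set L :=
  [set (map_poly iota p).[lambda] | p in [set p : {poly K} | (size p <= k)%N]].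

Lemma poly_valuesB k x y : poly_values k x -> poly_values k y -> poly_values k (x - y).
Proof.
move=> [p sp <-] [q sq <-]; exists (p - q); last by rewrite rmorphB hornerD hornerN.
by rewrite /= (leq_trans (size_polyD _ _)) // size_polyN geq_max sp.
Qed.

Lemma poly_valuesZ k c x : poly_values k x -> poly_values k (iota c * x).
Proof.
move=> [p sp <-]; exists (c *: p); first exact: leq_trans (size_scale_leq _ _) sp.
by rewrite map_polyZ hornerZ.
Qed.

Lemma complete_poly_values k : complete_in absL (poly_values k).
Proof.
elim: k => [|k IH].
  move=> u Su _; exists 0; first by exists 0; rewrite /= ?size_poly0 // rmorph0 horner0.
  apply/(abs_cvgP nonarchL) => e e0; exists 0%N => n _.
  have [p /=] := Su n; rewrite leqn0 size_poly_eq0 => /eqP -> <-.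
  by rewrite rmorph0 horner0 subrr (nabs0 nonarchL).
have -> : poly_values k.+1 =
    [set z | exists c, poly_values k (z - iota c * lambda ^+ k)].
  apply/seteqP; split=> [_ [p /= sp <-]|z [c [q /= sq e]]].
    exists p`_k; exists (p - p`_k *: 'X^k).
      apply/leq_sizeP => j; rewrite leq_eqVlt coefB coefZ coefXn => /orP[/eqP <-|kj].
        by rewrite eqxx mulr1 subrr.
      by rewrite gtn_eqF // mulr0 subr0 nth_default // (leq_trans sp).
    by rewrite rmorphB /= hornerD hornerN map_polyZ hornerZ map_polyXn hornerXn.
  exists (q + c *: 'X^k).
    rewrite /= (leq_trans (size_polyD _ _)) // geq_max (leq_trans sq) //=.
    by rewrite (leq_trans (size_scale_leq _ _)) // size_polyXn.
  by rewrite rmorphD /= hornerD map_polyZ hornerZ map_polyXn hornerXn e subrK.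
apply: complete_in_add_line => //; [exact: poly_valuesB | exact: poly_valuesZ].
Qed.

End FiniteExtension.

(** * The ring [K[lambda]] *)

Section Adjoin.
Variables (K : fieldType) (L : closedFieldType) (iota : {rmorphism K -> L}).
Variable lambda : L.

(** Euclidean division by ['X^n - a%:P], which vanishes at [lambda] but need not be its minimal
    polynomial. *)
Lemma adjoin_poly_values n a : (0 < n)%N -> lambda ^+ n = iota a ->
  adjoin iota lambda = poly_values iota lambda n.
Proof.
move=> n0 ln; apply/seteqP; split=> [_ [p _ <-]|_ [p _ <-]]; last by exists p.
exists (p %% ('X^n - a%:P)).
  by rewrite /= -ltnS -(size_XnsubC a n0) ltn_modp -size_poly_eq0 size_XnsubC.
rewrite [in RHS](divp_eq p ('X^n - a%:P)) rmorphD rmorphM rmorphB /=.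
rewrite map_polyXn map_polyC hornerD hornerM hornerD hornerN hornerXn hornerC.
by rewrite ln subrr mulr0 add0r.
Qed.

Lemma adjoin_iota c : adjoin iota lambda (iota c).
Proof. by exists c%:P => //; rewrite map_polyC hornerC. Qed.

Lemma adjoin_gen : adjoin iota lambda lambda.
Proof. by exists 'X => //; rewrite map_polyX hornerX. Qed.

Lemma adjoin_rational_subring : rational_subring (adjoin iota lambda).
Proof.
split=> [|_ _ [p _ <-] [q _ <-]|_ _ [p _ <-] [q _ <-]|n].
- by rewrite -(rmorph1 iota); apply: adjoin_iota.
- by exists (p - q) => //; rewrite rmorphB hornerD hornerN.
- by exists (p * q) => //; rewrite rmorphM hornerM.
by rewrite -(rmorph_nat iota) -fmorphV; apply: adjoin_iota.
Qed.

End Adjoin.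

(** * Linear maps and semiconjugacies *)

Section Conjugacy.
Variable L : fieldType.
Implicit Types (f g h p q : fps L) (c : L).

Definition flin c : fps L := fC c * fX.

Lemma flinE c : ps_linear c = flin c.
Proof. by apply/funext => n; rewrite /flin fCM. Qed.

Lemma flin_0 c : flin c 0%N = 0. Proof. by rewrite /flin fCM mulr0. Qed.
Lemma flin_1 c : flin c 1%N = c. Proof. by rewrite /flin fCM mulr1. Qed.

Lemma flin_comp c f : f 0%N = 0 -> fcomp (flin c) f = fC c * f.
Proof. by move=> f0; rewrite /flin fcompM // fcompC fcompX. Qed.

Lemma coef_comp_flin c f n : fcomp f (flin c) n = f n * c ^+ n.
Proof.
rewrite (@fcompE _ n) ?flin_0 // (bigD1 ord_max) //= big1 ?addr0 => [|i /eqP ni].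
  by rewrite /flin exprMn -rmorphXn fCM fXn eqxx mulr1.
rewrite /flin exprMn -rmorphXn fCM fXn; case: eqP; rewrite ?mulr0 // => e.
by case: ni; apply: val_inj.
Qed.

Lemma flinK c : c != 0 -> fcomp (flin c) (flin c^-1) = fX.
Proof.
move=> c0; rewrite flin_comp ?flin_0 // /flin mulrA -rmorphM divff //.
by rewrite rmorph1 mul1r.
Qed.

(** Free of inverses, unlike [ps_conjugate], so that such relations chain by substitution. *)
Definition semiconj p f g := fcomp g p = fcomp p f.

Lemma semiconj_comp p q f g h : f 0%N = 0 -> g 0%N = 0 -> p 0%N = 0 -> q 0%N = 0 ->
  semiconj p f g -> semiconj q g h -> semiconj (fcomp q p) f h.
Proof.
rewrite /semiconj => f0 g0 p0 q0 e1 e2.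
by rewrite -fcompA // e2 !fcompA // e1.
Qed.

Lemma semiconj_inv p q f g : f 0%N = 0 -> g 0%N = 0 -> p 0%N = 0 -> q 0%N = 0 ->
  fcomp p q = fX -> fcomp q p = fX -> semiconj p f g -> semiconj q g f.
Proof.
rewrite /semiconj => f0 g0 p0 q0 pq qp e.
have fq0 : fcomp f q 0%N = 0 by rewrite fcomp_0.
rewrite -[g in RHS]fcomp_fX -pq -(fcompA g) // e fcompA //.
by rewrite -fcompA // qp fcompX.
Qed.

Lemma ps_conjugate_semiconj h f g : f 0%N = 0 -> ps_conjugate h f g ->
  exists k : fps L, [/\ h 0%N = 0, k 0%N = 0, fcomp h k = fX, fcomp k h = fX &
    semiconj h f g].
Proof.
move=> f0 [k [h0 k0 hk kh] ->]; exists k; split=> //.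
have fk0 : fcomp f k 0%N = 0 by rewrite fcomp_0.
rewrite /semiconj -/(fcomp f k) -/(fcomp h _) fcompA // fcompA //.
by rewrite (_ : fcomp k h = fX) // fcomp_fX.
Qed.

Lemma semiconj_ps_conjugate h (k : fps L) f g :
  h 0%N = 0 -> k 0%N = 0 -> fcomp h k = fX -> fcomp k h = fX ->
  f 0%N = 0 -> semiconj h f g -> ps_conjugate h f g.
Proof.
move=> h0 k0 hk kh f0 e; exists k => //.
by rewrite -/(fcomp f k) -/(fcomp h _) -fcompA // -e fcompA // hk fcomp_fX.
Qed.

End Conjugacy.

(** * Extension of scalars for series *)

Section CoefficientEmbedding.
Variables (K L : fieldType) (iota : {rmorphism K -> L}).

Definition fmap (a : fps K) : fps L := fun n => iota (a n).

Lemma fmapM a b : fmap (a * b) = fmap a * fmap b.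
Proof.
apply/funext => n; rewrite /fmap !fpsM rmorph_sum.
by apply: eq_bigr => i _; rewrite rmorphM.
Qed.

Lemma fmapX a n : fmap (a ^+ n) = fmap a ^+ n.
Proof.
elim: n => [|n IH]; last by rewrite !exprS fmapM IH.
by apply/funext => n; rewrite /fmap !expr0 !fps1 rmorph_nat.
Qed.

Lemma fmap_comp a b : fmap (fcomp a b) = fcomp (fmap a) (fmap b).
Proof.
apply/funext => n; rewrite /fmap rmorph_sum.
by apply: eq_bigr => i _; rewrite rmorphM !ps_expE -fmapX.
Qed.

End CoefficientEmbedding.

(** * Existence over [K[lambda]] and invariance over [Kbar] *)

Theorem theorem1p1
  (R : realType) (K : fieldType) (abs : K -> R)
  (charK : [pchar K] =i pred0)
  (absK : nonarch_abs abs)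
  (abs_nontrivial : nontrivial_abs abs)
  (abs_complete : complete_abs abs)
  (Kbar : closedFieldType) (iota : {rmorphism K -> Kbar})
  (Kbar_closure : is_algebraic_closure iota)
  (absbar : Kbar -> R)
  (absKbar : nonarch_abs absbar)
  (absbar_ext : forall x : K, absbar (iota x) = abs x)
  (f : nat -> K) (m : nat)
  (f_analytic : analytic abs [set: K] f)
  (f_order : tangent_order f m)
  (lambda : Kbar)
  (lambda_root : lambda ^+ m.-1 = iota (f m)) :
  (exists (mu : Kbar) (h : nat -> Kbar),
     normal_form iota absbar f m lambda mu h) /\
  (forall (mu : Kbar) (h : nat -> Kbar),
     normal_form iota absbar f m lambda mu h ->
   forall g : nat -> K,
     analytic abs [set: K] g -> tangent_id g -> g <> ps_X K ->
     (exists k : nat -> K,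
        [/\ analytic abs [set: K] k, k 0%N = 0, k 1%N != 0 &
            ps_conjugate k f g]) ->
   forall (m' : nat) (lambda' mu' : Kbar) (h' : nat -> Kbar),
     normal_form iota absbar g m' lambda' mu' h' ->
     m' = m /\ mu' = mu).
Proof.
have char0 n : n.+1%:R != 0 :> Kbar.
  by rewrite -(rmorph_nat iota) fmorph_eq0 (pcharf0P K).1.
have root_neq0 g n l : tangent_order g n -> l ^+ n.-1 = iota (g n) -> l != 0.
  move=> [_ n2 _ gn] e; apply/eqP => l0.
  case/negP: gn; rewrite -(fmorph_eq0 iota) -e l0 expr0n.
  have -> : (n.-1 == 0)%N = false by lia.
  exact: eqxx.
pose F (l : Kbar) (g : nat -> K) : fps Kbar :=
  fcomp (flin l) (fcomp (fmap iota g) (flin l^-1)).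
have FE l (g : nat -> K) : g 0%N = 0 ->
    ps_comp (ps_linear l) (ps_comp (fun n => iota (g n)) (ps_linear l^-1)) = F l g.
  by move=> g0; rewrite /F !flinE.
have F0 l (g : nat -> K) : F l g 0%N = 0 by rewrite /F fcomp_0 flin_0.
split.
  have [f1 m2 flow fm] := f_order.
  have lambda0 := root_neq0 _ _ _ f_order lambda_root.
  have f0 : f 0%N = 0 by case: f1.
  have fc0 : fmap iota f 0%N = 0 by rewrite /fmap f0 rmorph0.
  pose d := m.-1; have d0 : (0 < d)%N by rewrite /d; lia.
  have dm : d.+1 = m by rewrite /d; lia.
  set S := adjoin iota lambda.
  have Sring : rational_subring S by exact: adjoin_rational_subring.
  have Scomplete : complete_in absbar S.
    rewrite /S (adjoin_poly_values d0 lambda_root).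
    exact: (complete_poly_values abs_complete absKbar absbar_ext).
  have FnE n : F lambda f n = lambda * (iota (f n) * lambda^-1 ^+ n).
    rewrite /F flin_comp ?fCM ?coef_comp_flin //.
    by rewrite fc0 mul0r.
  (* [S] is only known to be a ring; the inverse comes from [lambda ^ d = f m]. *)
  have lambdaV : S lambda^-1.
    have -> : lambda^-1 = lambda ^+ d.-1 * iota (f m)^-1.
      rewrite fmorphV -lambda_root -/d -{2}(prednK d0) exprS invfM mulrCA.
      by rewrite divff ?expf_neq0 // mulr1.
    apply: (subr_mul Sring); last exact: adjoin_iota.
    by apply: subr_exp => //; apply: adjoin_gen.
  have gF : geometric absbar S (F lambda f).
    have [x [x0 x1]] : exists x : K, x != 0 /\ abs x < 1.
      have [x x0 /eqP x1] := abs_nontrivial.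
      have [lt|gt|//] := ltgtP (abs x) 1; first by exists x.
      exists x^-1; rewrite invr_eq0 x0 (nabsV absK) invf_lt1 //.
      by apply: lt_trans gt.
    have [M [r [r0 fb]]] := analytic_fbound absK x0 x1 (fun=> I) f_analytic.
    apply: (@geometricI _ _ _ _ _ (absbar lambda * M) (r / absbar lambda)).
    - by rewrite divr_ge0 // (nabs_ge0 absKbar).
    - move=> n; rewrite FnE; apply: (subr_mul Sring); first exact: adjoin_gen.
      apply: (subr_mul Sring); first exact: adjoin_iota.
      exact: subr_exp.
    move=> n; rewrite FnE !(nabsM absKbar) absbar_ext (nabsX absKbar) (nabsV absKbar).
    rewrite exprMn -mulrA; apply: ler_wpM2l; first exact: nabs_ge0.
    rewrite mulrA; apply: ler_wpM2r; last exact: fb.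
    by rewrite exprn_ge0 // invr_ge0 (nabs_ge0 absKbar).
  have FX : eqm d.+1 (F lambda f) fX.
    move=> i; rewrite FnE dm => im.
    case: i im => [|[|i]] im.
    - by rewrite f0 rmorph0 mul0r mulr0.
    - by case: f1 => _ ->; rewrite rmorph1 mul1r expr1 divff.
    by rewrite flow // rmorph0 mul0r mulr0.
  (* The reason for choosing [lambda]: the rescaling turns [f m] into [f m / lambda ^ m.-1]. *)
  have Fd : F lambda f d.+1 = 1.
    rewrite FnE dm -lambda_root -/d -dm exprVn mulrA -exprS divff //.
    by rewrite expf_neq0.
  have [mu [h [Smu gh h0 h1 e]]] :=
    geometric_normal_form absKbar char0 Sring d0 gF (F0 _ _) FX Fd.
  have [k gk [k0 k1 hk kh]] := geometric_compositional_inverse absKbar Sring gh h0 h1.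
  exists mu, h; split=> //.
    by split; [exact: geometric_analytic | split].
  rewrite FE // fnormalE -dm.
  apply: (semiconj_ps_conjugate h0 k0 hk kh (F0 _ _)).
  by rewrite /semiconj -e.
move=> mu h [_ _ _ [_ th] ch] g _ tg _ [k [_ k0 k1 ck]] m' lambda' mu' h'.
move=> [g_order lambda_root' _ [_ th'] ch'].
have [[f0 _] m2 _ _] := f_order; have [[g0 _] m'2 _ _] := g_order.
have l0 := root_neq0 _ _ _ f_order lambda_root.
have l'0 := root_neq0 _ _ _ g_order lambda_root'.
rewrite FE // fnormalE in ch; rewrite FE // fnormalE in ch'.
have [hi [h0 hi0 hhi hih sh]] := ps_conjugate_semiconj (F0 _ _) ch.
have [_ [h'0 _ _ _ sh']] := ps_conjugate_semiconj (F0 _ _) ch'.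
have [ki [_ ki0 kki kik sk]] := ps_conjugate_semiconj f0 ck.
have N0 n c : (1 < n)%N -> fnormal n c 0%N = 0 :> Kbar.
  by move=> n1; rewrite fnormal_eqm // ltnW.
pose jf := fmap iota f; pose jg := fmap iota g; pose jk := fmap iota k.
have map0 (a : nat -> K) : a 0%N = 0 -> fmap iota a 0%N = 0.
  by rewrite /fmap => ->; rewrite rmorph0.
have sk' : semiconj jk jf jg by rewrite /semiconj -!fmap_comp sk.
have slin l (a : nat -> K) : l != 0 -> a 0%N = 0 -> semiconj (flin l) (fmap iota a) (F l a).
  move=> ln a0; rewrite /semiconj /F fcompA ?flin_0 ?fcomp_0 ?map0 //.
  have := flinK (invr_neq0 ln); rewrite invrK => ll.
  by rewrite fcompA ?flin_0 // ll fcomp_fX.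
have slin' l (a : nat -> K) : l != 0 -> a 0%N = 0 ->
    semiconj (flin l^-1) (F l a) (fmap iota a).
  move=> ln a0; have := flinK (invr_neq0 ln); rewrite invrK => ll.
  by apply: semiconj_inv (flinK ln) ll (slin _ _ ln a0); rewrite ?flin_0 ?map0.
(* A chain from the first normal form through [F lambda f], [f], [g] and [F lambda' g] to the
   second. Each link has a nonzero linear coefficient, as [normal_form_invariants] requires of the
   composite. *)
have s1 : semiconj hi (fnormal m mu) (F lambda f).
  by apply: semiconj_inv hhi hih sh => //; apply: N0.
have s2 := semiconj_comp (N0 _ _ m2) (F0 _ _) hi0 (flin_0 _) s1 (slin' _ _ l0 f0).
have p20 : fcomp (flin lambda^-1) hi 0%N = 0 by rewrite fcomp_0 flin_0.
have s3 := semiconj_comp (N0 _ _ m2) (map0 _ f0) p20 (map0 _ k0) s2 sk'.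
have p30 : fcomp jk (fcomp (flin lambda^-1) hi) 0%N = 0 by rewrite fcomp_0 /jk map0.
have s4 := semiconj_comp (N0 _ _ m2) (map0 _ g0) p30 (flin_0 _) s3 (slin _ _ l'0 g0).
have p40 : fcomp (flin lambda') (fcomp jk (fcomp (flin lambda^-1) hi)) 0%N = 0.
  by rewrite fcomp_0 flin_0.
have s5 := semiconj_comp (N0 _ _ m2) (F0 _ _) p40 h'0 s4 sh'.
apply: (normal_form_invariants char0 m2 m'2 _ _ (esym s5)); first by rewrite fcomp_0.
rewrite !fcomp_1 // !flin_1 /jk /fmap.
have hi1 : hi 1%N != 0.
  apply/eqP => hi1; have := congr1 (fun c : fps Kbar => c 1%N) hhi.
  by rewrite fcomp_1 // hi1 mulr0 => /esym/eqP; rewrite oner_eq0.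
case: th' => _ ->; rewrite mul1r !mulf_neq0 ?invr_neq0 //.
by rewrite fmorph_eq0.
Qed.
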